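(* Let $q$ be a prime power and $m$ a positive integer. If $q$ is not a power of three, then \[ |\mathrm{TSRI}(m,3,q)|=\frac{q\,|\mathrm{GL}_m(\mathbb{F}_q)|}{3m(q^m-1)}\sum_{d\mid m,\ 3\nmid d}\mu(d)\bigl(q+\varepsilon^{m/d}\bigr)\bigl(q^{m/d}-\varepsilon^{m/d}\bigr), \] where $\varepsilon=\left(\frac{q}{3}\right)$ is the Legendre symbol. If $q$ is a power of $3$, then \[ |\mathrm{TSRI}(m,3,q)|=\frac{(q-1)\,|\mathrm{GL}_m(\mathbb{F}_q)|}{3m(q^m-1)}\sum_{d\mid m,\ 3\nmid d}\mu(d)\left(q+\frac{3+(-1)^{m/d}}{2}\right)q^{m/d}. \]
   Context: $\mu$ is the Möbius function, the sums run over positive divisors $d$ of $m$ not divisible by $3$, and $|\mathrm{GL}_m(\mathbb{F}_q)|=\prod_{i=0}^{m-1}(q^m-q^i)$. The Legendre symbol $\left(\frac{q}{3}\right)$ equals $\pm1$ according to whether $q\equiv\pm1\pmod 3$. Transformation shift registers (TSRs): let $m,n$ be positive integers. Given $c_0,\dots,c_{n-1}\in\mathbb{F}_q$ and an $m\times m$ matrix $A$ over $\mathbb{F}_q$, identify $\mathbb{F}_{q^m}$ with the space $\mathbb{F}_q^m$ of row vectors; the recursion $s_{i+n}=(c_0s_i+c_1s_{i+1}+\cdots+c_{n-1}s_{i+n-1})A$ for $i\ge 0$ is a TSR of order $n$ over $\mathbb{F}_{q^m}$. It is identified with its $mn\times mn$ state transition matrix over $\mathbb{F}_q$, the block companion matrix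 \[ T=\begin{pmatrix}0&0&\cdots&0&c_0A\\ I_m&0&\cdots&0&c_1A\\ 0&I_m&\cdots&0&c_2A\\ \vdots&&\ddots&&\vdots\\ 0&0&\cdots&I_m&c_{n-1}A\end{pmatrix} \] (so choices of $(c_0,\dots,c_{n-1},A)$ giving the same matrix $T$ are the same TSR; for $n=1$, $T=c_0A$). The TSR is called irreducible if the characteristic polynomial of $T$ is irreducible in $\mathbb{F}_q[x]$. $\mathrm{TSRI}(m,n,q)$ denotes the set of irreducible TSRs of order $n$ over $\mathbb{F}_{q^m}$, i.e. the set of such matrices $T$ with irreducible characteristic polynomial. *)

(* Defs.v *)
From mathcomp Require Import all_boot all_order all_fingroup all_algebra.

Set Implicit Arguments.
Unset Strict Implicit.
Unset Printing Implicit Defensive.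

Import GRing.Theory Num.Theory.
Local Open Scope ring_scope.

Definition mobius (d : nat) : int :=
  if (0 < d)%N && all (fun p => logn p d == 1%N) (primes d)
  then (-1) ^+ size (primes d) else 0.

(* Meaningful for an odd prime p. *)
Definition legendre (a p : nat) : int :=
  if (p %| a)%N then 0
  else if [exists x : 'I_p, (x ^ 2 == a %[mod p])%N] then 1 else -1.

(* An n x n array of m x m blocks, of size \sum_(i < n) m, acting on row
   vectors (s_i, ..., s_(i+n-1)).  For n = 1 the only block is c_0 A. *)
Definition tsr_mx (F : finFieldType) (m n : nat)
    (c : {ffun 'I_n -> F}) (A : 'M[F]_m) : 'M[F]_(\sum_(i < n) m) :=
  \mxblock_(i < n, j < n)
    (if j.+1 == n then c i *: A else if i == j.+1 :> nat then 1%:M else 0).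

Definition TSR (F : finFieldType) (m n : nat) : {set 'M[F]_(\sum_(i < n) m)} :=
  [set tsr_mx c A | c : {ffun 'I_n -> F}, A : 'M[F]_m].

(* [irreducibleb] decides [irreducible_poly] ([irreducibleP]). *)
Definition TSRI (F : finFieldType) (m n : nat) :
    {set 'M[F]_(\sum_(i < n) m)} :=
  [set T in TSR F m n | irreducibleb (char_poly T)].

(* Main.v *)
From HB Require Import structures.
Require Import Defs.
From mathcomp Require Import all_boot all_order all_fingroup all_algebra all_field.
From mathcomp Require Import ring zify.

(** Let T be a shift register with coefficients c and matrix A. An eigenvector of T
    for x has the form (u, x u, x^2 u) with x^3 u = (c 0 + c 1 x + c 2 x^2) u A
    ([eigenvalue_tsrP]), so x^3 / (c 0 + c 1 x + c 2 x^2) is an eigenvalue of A.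
    All roots live in a finite extension E of F that is large enough for the
    polynomials involved to split ([splitting_extension]), and degrees over F are
    orbit lengths of Frobenius. The characteristic polynomial of T is irreducible
    exactly when it has a root x of degree 3 m. Then c 0 != 0, the eigenvalue of A
    has degree m, and A can be rescaled in a unique way to have c 0 = 1
    ([deg_ratio], [card_TSRI_normal]). In terms of y = 1 / x the inverse g of the
    eigenvalue is the value at y of the cubic h = Y^3 + a Y^2 + b Y with a = c 1 and
    b = c 2.

    An element g of degree m has a preimage of degree 3 m under h exactly when it
    has none in F_(q^m) ([missed_degE], [deg3_missed]): Frobenius over F_(q^m)
    then permutes the three roots of h - g cyclically. A given g is an inverse
    eigenvalue of |GL_m| / (q^m - 1) matrices ([card_eigenvalue]), and a given
    matrix has m conjugate eigenvalues. Thus m (q^m - 1) times the number of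
    irreducible registers is |GL_m| times the number of triples (a, b, g) with g of
    degree m and missed by h over F_(q^m) ([card_TSRI]).

    A value g of degree d dividing n is missed over F_(q^n) if and only if it is
    missed over F_(q^d) and 3 does not divide n / d ([missed_Fix]). A Moebius
    inversion over the divisors prime to 3 therefore expresses the number of missed
    g of exact degree m through the numbers of all g in F_(q^n) missed over F_(q^n),
    for n dividing m ([sum_deg_missed]).

    Over a finite field K, inspection of the fibres of h shows that three times the
    number of missed values, plus the number of triple roots, is the number of
    points of the affine conic (h(Y) - h(Z)) / (Y - Z) = 0 ([count_missed]). Away from
    characteristic 3 a translation turns the conic into Y^2 + Y Z + Z^2 = e, a norm
    form that splits over K if and only if |K| = 1 modulo 3; this is where the
    Legendre symbol comes from. In characteristic 3 the quadratic part of the conic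
    is (Y - Z)^2, and for a = 0 one counts the elements -b of F that are squares in
    F_(q^n), which depends on the parity of n. *)

Set Implicit Arguments.
Unset Strict Implicit.
Unset Printing Implicit Defensive.

Import GRing.Theory Num.Theory.
Local Open Scope ring_scope.

(** * Moebius inversion over divisors prime to a given prime *)

Section Moebius.

Lemma mobius_mul_prime p e : prime p -> (0 < e)%N -> ~~ (p %| e)%N ->
  mobius (p * e) = - mobius e.
Proof.
move=> p_pr e_gt0 pNe; have p_gt0 := prime_gt0 p_pr.
have pNe' : p \notin primes e by rewrite mem_primes p_pr e_gt0.
have perm_pe : perm_eq (primes (p * e)) (p :: primes e).
  apply: uniq_perm; rewrite /= ?primes_uniq ?pNe' // => r.
  by rewrite primesM // primes_prime // !inE.
rewrite /mobius muln_gt0 p_gt0 e_gt0 /= (perm_size perm_pe) (perm_all _ perm_pe) /=.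
rewrite lognM // logn_prime // eqxx (_ : logn p e = 0%N) ?addn0 /=; last first.
  by apply/eqP; rewrite -leqn0 leqNgt logn_gt0.
rewrite (_ : all _ (primes e) = all (fun r => logn r e == 1%N) (primes e)).
  by case: ifP => _; rewrite ?oppr0 // exprS mulN1r.
apply: eq_in_all => r re; rewrite lognM // logn_prime //.
by rewrite (_ : (r == p) = false) //; apply: contraNF pNe' => /eqP<-.
Qed.

Lemma mobius_mul_prime0 p e : prime p -> (0 < e)%N -> (p %| e)%N ->
  mobius (p * e) = 0.
Proof.
move=> p_pr e_gt0 pe; have p_gt0 := prime_gt0 p_pr.
rewrite /mobius; case: ifP => // /andP[pe_gt0 /allP/(_ p)].
have le : (0 < logn p e)%N by rewrite logn_gt0 mem_primes p_pr e_gt0.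
rewrite mem_primes p_pr pe_gt0 dvdn_mulr // lognM // logn_prime // eqxx.
by case: (logn p e) le => // k _ /(_ isT).
Qed.

(** For the least prime p dividing n, the divisor e prime to p cancels against
    p * e, and the divisors that p divides twice contribute nothing. *)
Lemma sum_mobius n : (0 < n)%N ->
  \sum_(d <- divisors n) mobius d = (n == 1%N)%:R.
Proof.
rewrite leq_eqVlt => /predU1P[<-|n_gt1].
  by rewrite (_ : divisors 1 = [:: 1%N]) // big_seq1.
have p_pr := pdiv_prime n_gt1; set p := pdiv n in p_pr.
have [k def_n] : exists k, n = (p * k)%N.
  by have /dvdnP[k ->] := pdiv_dvd n; exists k; rewrite mulnC.
have [n_gt0 p_gt0] := (ltnW n_gt1, prime_gt0 p_pr).
have k_gt0 : (0 < k)%N by move: n_gt0; rewrite def_n muln_gt0 => /andP[].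
rewrite gtn_eqF // (bigID (fun d => p %| d)%N) /=.
rewrite -big_filter (perm_big [seq (p * e)%N | e <- divisors k]); last first.
  apply: uniq_perm; rewrite ?filter_uniq ?divisors_uniq //.
    rewrite map_inj_uniq ?divisors_uniq // => x y /eqP.
    by rewrite eqn_pmul2l // => /eqP.
  move=> d; rewrite mem_filter -dvdn_divisors //; apply/andP/mapP.
    case=> /dvdnP[e ->] en; exists e; last by rewrite mulnC.
    by rewrite -dvdn_divisors //; move: en; rewrite def_n mulnC dvdn_pmul2l.
  case=> e; rewrite -dvdn_divisors // => ek ->.
  by rewrite dvdn_mulr // def_n dvdn_pmul2l.
rewrite big_map (bigID (fun d => p %| d)%N) /= big1_seq ?add0r; last first.
  move=> e /andP[pe]; rewrite -dvdn_divisors // => /(dvdn_gt0 k_gt0) e_gt0.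
  exact: mobius_mul_prime0.
rewrite -[X in _ + X]big_filter [X in _ + X](perm_big [seq d <- divisors k | ~~ (p %| d)%N]).
  rewrite /= big_filter -big_split big1_seq // => e /andP[pNe].
  rewrite -dvdn_divisors // => /(dvdn_gt0 k_gt0) e_gt0.
  by rewrite mobius_mul_prime //; apply: addNr.
apply: uniq_perm; rewrite ?filter_uniq ?divisors_uniq // => d.
rewrite !mem_filter -!dvdn_divisors //; case: (boolP (p %| d)%N) => //= pNd.
by rewrite def_n Gauss_dvdr // coprime_sym prime_coprime.
Qed.

Lemma perm_divisors n m : (0 < m)%N -> (n %| m)%N ->
  perm_eq (divisors n) [seq d <- divisors m | (d %| n)%N].
Proof.
move=> m_gt0 nm; have n_gt0 := dvdn_gt0 m_gt0 nm.
apply: uniq_perm; rewrite ?filter_uniq ?divisors_uniq // => d.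
rewrite mem_filter -!dvdn_divisors //; apply/idP/andP => [dn|[]//].
by split=> //; apply: dvdn_trans nm.
Qed.

(** Inversion still works when the divisor sum is restricted to d with l not
    dividing n / d: a prime l fails to divide m / d = e * (m / (e d)) exactly
    when it divides neither factor, so after exchanging the sums every d with
    m / d prime to l meets the full Moebius sum over the divisors of m / d. *)
Lemma mobius_inversion_prime_to (R : pzRingType) (l m : nat) (f g : nat -> R) :
    prime l -> (0 < m)%N ->
    (forall n, (n %| m)%N ->
       f n = \sum_(d <- divisors n | ~~ (l %| n %/ d)%N) g d) ->
  g m = \sum_(e <- divisors m | ~~ (l %| e)%N) (mobius e)%:~R * f (m %/ e)%N.
Proof.
move=> l_pr m_gt0 fE.
pose P d e := [&& ~~ (l %| e), e * d %| m & ~~ (l %| m %/ e %/ d)]%N.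
transitivity (\sum_(e <- divisors m) \sum_(d <- divisors m | P d e)
    (mobius e)%:~R * g d); last first.
  rewrite [RHS]big_mkcond /=; apply: eq_big_seq => e; rewrite -dvdn_divisors //.
  move=> em; have e_gt0 := dvdn_gt0 m_gt0 em; rewrite /P.
  case: ifP => l_e /=; last by rewrite big_pred0.
  have me_m : (m %/ e %| m)%N by apply: dvdn_div.
  rewrite fE // (perm_big _ (perm_divisors m_gt0 me_m)) big_filter_cond big_distrr /=.
  by apply: eq_bigl => d; rewrite (dvdn_divRL d em) mulnC.
rewrite (exchange_big_dep xpredT) /= //.
transitivity (\sum_(d <- divisors m) (if d == m then g d else 0)).
  rewrite -big_mkcond -big_filter (perm_big [:: m]) ?big_seq1 //.
  apply: uniq_perm; rewrite ?filter_uniq ?divisors_uniq // => d.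
  by rewrite mem_filter inE -dvdn_divisors //; case: eqP => //= ->; rewrite dvdnn.
apply: eq_big_seq => d; rewrite -dvdn_divisors // => dm.
have d_gt0 := dvdn_gt0 m_gt0 dm; have md_gt0 : (0 < m %/ d)%N by rewrite divn_gt0 // dvdn_leq.
have md_m : (m %/ d %| m)%N by apply: dvdn_div.
rewrite -big_distrl /=.
have PE e : (e %| m)%N -> P d e = ~~ (l %| m %/ d)%N && (e %| m %/ d)%N.
  move=> em; rewrite /P (dvdn_divRL e dm).
  case: (boolP (e * d %| m)%N) => [edm|_]; last by rewrite !andbF.
  rewrite andbT /= -negb_or -Euclid_dvdM //; congr (~~ (_ %| _)%N).
  by rewrite -divnMA [(e * d)%N]mulnC divnMA mulnC divnK // dvdn_divRL.
have [l_md|lNmd] := boolP (l %| m %/ d)%N.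
  rewrite big1_seq ?mul0r => [|e /andP[Pe]]; last first.
    by rewrite -dvdn_divisors // => em; rewrite PE // l_md in Pe.
  case: eqP => // dE; move: l_md; rewrite dE divnn m_gt0 dvdn1.
  by rewrite gtn_eqF // prime_gt1.
rewrite big_seq_cond (eq_bigl (fun e => (e \in divisors m) && (e %| m %/ d)%N)); last first.
  by move=> e; rewrite -dvdn_divisors //; case: (boolP (e %| m)%N) => //= em; rewrite PE // lNmd.
rewrite -big_seq_cond -big_filter -(perm_big _ (perm_divisors m_gt0 md_m)).
rewrite -(rmorph_sum (intmul 1)) sum_mobius //.
have -> : (m %/ d == 1)%N = (d == m) by rewrite [LHS]eq_sym eqn_div // mul1n.
by case: eqP => _ /=; rewrite ?mul1r ?mul0r.
Qed.

End Moebius.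

(** * A finite extension in which polynomials of bounded degree split *)

(** One splitting field serves all these polynomials at once: take it for the
    product of all nonzero polynomials of size at most N. *)
Lemma splitting_extension (F : finFieldType) (N : nat) :
  exists (E : finFieldType) (iota : {rmorphism F -> E}),
    forall p : {poly F}, p != 0 -> (size p <= N)%N ->
      exists rs : seq E, map_poly iota p %= \prod_(r <- rs) ('X - r%:P).
Proof.
pose P := \prod_(v : 'rV[F]_N | rVpoly v != 0) rVpoly v.
have P0 : P != 0 by apply/prodf_neq0.
have [L [rs rsP _]] := FinSplittingFieldFor P0.
exists (finvect_type L), (in_alg (finvect_type L)) => p p0 sp.
have pP : p %| P.
  rewrite /P (bigD1 (poly_rV p)) /= poly_rV_K //.
  exact: dvdp_mulr.
have : map_poly (in_alg (finvect_type L)) p %| \prod_(r <- rs) ('X - r%:P).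
  by rewrite -(eqp_dvdr _ rsP) dvdp_map.
move=> /dvdp_prod_XsubC [b hb]; by exists (mask b rs).
Qed.

(** * Frobenius, fixed fields and degrees over F *)

(** The argument of morphism type fixes E as an extension of F; the additivity
    of this map depends on it. *)
Definition frob (F E : finFieldType) of {rmorphism F -> E} :=
  fun (d : nat) (x : E) => x ^+ (#|F| ^ d).

Section Frobenius.

Variables (F E : finFieldType) (emb : {rmorphism F -> E}).
Local Notation q := #|F|.
Local Notation phi := (frob emb).

Lemma pchar_card_nat d : [pchar E].-nat (q ^ d)%N.
Proof.
have [p p_pr pF] := finPcharP F.
have pE : p \in [pchar E] by rewrite (fmorph_pchar emb).
have -> : q = #|pPrimeCharType pF| by [].
rewrite pnatX; apply/orP; left; rewrite card_pprimeChar.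
by rewrite pnatX pnatE ?pE.
Qed.

Lemma frob_is_additive d : zmod_morphism (phi d).
Proof.
by move=> x y; rewrite /frob exprDn_pchar ?exprNn_pchar ?pchar_card_nat.
Qed.

Lemma frob_is_multiplicative d : monoid_morphism (phi d).
Proof. by split=> [|x y]; rewrite /frob ?expr1n ?exprMn. Qed.

HB.instance Definition _ d :=
  GRing.isZmodMorphism.Build E E (phi d) (frob_is_additive d).
HB.instance Definition _ d :=
  GRing.isMonoidMorphism.Build E E (phi d) (frob_is_multiplicative d).

Lemma frobD_exp a b x : phi (a + b) x = phi a (phi b x).
Proof. by rewrite /frob -exprM expnD mulnC. Qed.

Lemma frob0 x : phi 0 x = x. Proof. by rewrite /frob expn0 expr1. Qed.

Lemma iter_frob n x : iter n (phi 1) x = phi n x.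
Proof. by elim: n => [|n IHn]; rewrite ?frob0 //= IHn -frobD_exp. Qed.

Lemma frob_inj d : injective (phi d).
Proof. exact: fmorph_inj. Qed.

Lemma frob_emb d a : phi d (emb a) = emb a.
Proof.
elim: d => [|d IHd]; first by rewrite frob0.
by rewrite -add1n frobD_exp IHd /frob expn1 -rmorphXn /= expf_card.
Qed.

(** The degree of x over F: the conjugates of x form its Frobenius orbit. *)
Definition deg (x : E) := fingraph.order (phi 1) x.

Lemma deg_gt0 x : (0 < deg x)%N. Proof. exact: fingraph.order_gt0. Qed.

Lemma frob_deg x : phi (deg x) x = x.
Proof. by rewrite -iter_frob iter_order //; apply: frob_inj. Qed.

Lemma frob_degM k x : phi (k * deg x) x = x.
Proof. by elim: k => [|k IHk]; rewrite ?frob0 // mulSn addnC frobD_exp frob_deg. Qed.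

Lemma frob_ltn_inj x i j :
  (i < deg x)%N -> (j < deg x)%N -> phi i x = phi j x -> i = j.
Proof.
by move=> hi hj eq_ij; rewrite -(findex_iter hi) -(findex_iter hj) !iter_frob eq_ij.
Qed.

Lemma frob_fixE d x : (phi d x == x) = (deg x %| d)%N.
Proof.
apply/eqP/idP => [fix_x|/dvdnP[k ->]]; last exact: frob_degM.
rewrite (divn_eq d (deg x)) addnC frobD_exp frob_degM in fix_x.
by apply/eqP/(@frob_ltn_inj x); rewrite ?ltn_mod ?deg_gt0 // frob0.
Qed.

Lemma deg_emb a : deg (emb a) = 1%N.
Proof. by apply/eqP; rewrite -dvdn1 -frob_fixE frob_emb. Qed.

(** The intermediate field with q ^ d elements, when E is large enough to
    contain it. *)
Definition Fix d : {pred E} := [pred x | phi d x == x].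

Lemma FixE d x : (x \in Fix d) = (deg x %| d)%N.
Proof. by rewrite inE frob_fixE. Qed.

Lemma Fix_frob d x : x \in Fix d -> phi d x = x.
Proof. by rewrite inE => /eqP. Qed.

Fact Fix_divring_closed d : divring_closed (Fix d).
Proof.
split=> [|x y|x y]; rewrite !inE ?rmorph1 //.
  by move=> /eqP xK /eqP yK; rewrite rmorphB /= xK yK.
by move=> /eqP xK /eqP yK; rewrite fmorph_div /= xK yK.
Qed.
HB.instance Definition _ d := GRing.isDivringClosed.Build E (Fix d)
  (Fix_divring_closed d).

Lemma Fix_emb d a : emb a \in Fix d.
Proof. by rewrite FixE deg_emb dvd1n. Qed.

Lemma deg_conj i x : deg (phi i x) = deg x.
Proof.
have frobC a b y : phi a (phi b y) = phi b (phi a y).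
  by rewrite -!frobD_exp addnC.
apply/eqP; rewrite eqn_dvd -!frob_fixE frobC frob_deg eqxx /=.
by rewrite -(inj_eq (@frob_inj i)) -frobD_exp addnC frobD_exp frob_deg.
Qed.

Lemma degV x : deg x^-1 = deg x.
Proof.
apply/eqP; rewrite eqn_dvd -!frob_fixE !fmorphV /= frob_deg eqxx /=.
by rewrite -(inj_eq invr_inj) -[eqbLHS]fmorphV [eqbLHS]frob_deg.
Qed.

(** The q elements of F already exhaust the possible roots of X^q - X. *)
Lemma Fix1P x : x \in Fix 1 -> exists a, emb a = x.
Proof.
suff /eqP eq_Fix : [set emb a | a in F] == [set y in Fix 1].
  move=> xK; have : x \in [set y in Fix 1] by rewrite inE.
  by rewrite -eq_Fix => /imsetP[a _ ->]; exists a.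
rewrite eqEcard; apply/andP; split.
  by apply/subsetP => _ /imsetP[a _ ->]; rewrite inE Fix_emb.
rewrite cardsE (card_imset _ (fmorph_inj emb)) -ltnS.
have q_gt1 : (1 < q)%N := finNzRing_gt1 F.
have sz : size ('X^q - 'X : {poly E}) = q.+1.
  by rewrite size_polyDl ?size_polyXn // size_polyN size_polyX.
rewrite -[X in (_ < X)%N]sz cardE max_poly_roots ?enum_uniq //.
  by rewrite -size_poly_eq0 sz.
apply/allP => y; rewrite mem_enum inE /frob expn1 => /eqP yK.
by rewrite /root !hornerE yK subrr.
Qed.

Lemma map_poly_descent (p : {poly E}) :
  map_poly (phi 1) p = p -> exists r : {poly F}, p = map_poly emb r.
Proof.
move=> pK; have coefP i : exists a, emb a == p`_i.
  by have [|a <-] := @Fix1P p`_i; [by rewrite inE -coef_map pK|by exists a].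
exists (\poly_(i < size p) xchoose (coefP i)); apply/polyP => i.
rewrite coef_map coef_poly; case: ltnP => [_|h]; last by rewrite nth_default ?raddf0.
exact/esym/eqP/(xchooseP (coefP i)).
Qed.

Lemma frob_root b (p : {poly E}) i x :
  map_poly (phi b) p = p -> root p x -> root p (phi (i * b) x).
Proof.
move=> pK px; elim: i => [|i IHi]; first by rewrite frob0.
by rewrite mulSn frobD_exp -pK rmorph_root.
Qed.

(** The conjugates phi (i * b) x are also roots of p, and they are distinct as
    long as i * b < deg x. *)
Lemma deg_root_le b (p : {poly E}) x :
    (0 < b)%N -> p != 0 -> map_poly (phi b) p = p -> root p x ->
  (deg x <= (size p).-1 * b)%N.
Proof.
move=> b_gt0 p0 pK px; rewrite leqNgt; apply/negP => lt_deg.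
pose rs := [seq phi (i * b) x | i <- seq.iota 0 (size p)].
suff : (size rs < size p)%N by rewrite size_map size_iota ltnn.
apply: max_poly_roots => //.
  by apply/allP => _ /mapP[i _ ->]; apply: frob_root.
have lt_b i : (i < size p)%N -> (i * b < deg x)%N.
  move=> lt_i; apply: leq_ltn_trans lt_deg; rewrite leq_mul2r.
  by rewrite -ltnS prednK ?lt_i ?orbT // (leq_trans _ lt_i).
rewrite map_inj_in_uniq ?iota_uniq // => i j; rewrite !mem_iota !add0n /=.
move=> lt_i lt_j /frob_ltn_inj => /(_ (lt_b _ lt_i) (lt_b _ lt_j)) /eqP.
by rewrite eqn_pmul2r // => /eqP.
Qed.

Lemma map_frob_emb d (p : {poly F}) :
  map_poly (phi d) (map_poly emb p) = map_poly emb p.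
Proof. by rewrite -map_poly_comp; apply: eq_map_poly => a /=; rewrite frob_emb. Qed.

Lemma deg_root_emb_le (p : {poly F}) x :
  p != 0 -> root (map_poly emb p) x -> (deg x < size p)%N.
Proof.
move=> p0 px; have:= @deg_root_le 1 (map_poly emb p) x isT.
rewrite map_poly_eq0 map_frob_emb size_map_poly muln1 => /(_ p0 erefl px).
by rewrite -ltnS prednK // size_poly_gt0.
Qed.

(** The product of X - y over the Frobenius orbit of x is Frobenius-invariant,
    hence descends to F. *)
Lemma min_poly_ex x : exists r : {poly F},
  [/\ r \is monic, size r = (deg x).+1 & root (map_poly emb r) x].
Proof.
pose P := \prod_(i < deg x) ('X - (phi i x)%:P).
have [|r rP] := @map_poly_descent P.
  rewrite map_prod_XsubC /P; case: (deg x) (frob_deg x) => [|n] fx; first by rewrite !big_ord0.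
  rewrite big_ord_recr big_ord_recl /= -frobD_exp add1n fx frob0 mulrC.
  by congr (_ * _); apply: eq_bigr => i _; rewrite -frobD_exp.
exists r; split.
- by rewrite -(map_monic emb) -rP monic_prod_XsubC.
- by rewrite -(size_map_poly emb) -rP size_prod_XsubC /index_enum -enumT size_enum_ord.
- rewrite -rP /P; case: (deg x) (deg_gt0 x) => // n _.
  by rewrite big_ord_recl frob0 rootM root_XsubC eqxx.
Qed.

(** An irreducible p shares the root x with the minimal polynomial of x, so it
    divides it. *)
Lemma irreducible_deg (p : {poly F}) x :
  irreducible_poly p -> root (map_poly emb p) x -> deg x = (size p).-1.
Proof.
move=> p_irr px; have p0 := irredp_neq0 p_irr.
have [r [r_mon sz_r rx]] := min_poly_ex x.
have r0 := monic_neq0 r_mon.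
have p_r : p %| r.
  apply/negPn; rewrite -irreducible_poly_coprime // -(coprimep_map emb).
  by apply/negP => /coprimep_root -/(_ x px); rewrite (eqP rx) eqxx.
apply/eqP; rewrite eqn_leq -[X in _ && X]ltnS prednK ?size_poly_gt0 //.
by rewrite -ltnS prednK ?size_poly_gt0 // deg_root_emb_le // -sz_r dvdp_leq.
Qed.

(** In a factorisation of p, the factor that vanishes at x has at least deg x
    as its degree, which leaves a constant for the other. *)
Lemma deg_irreducible (p : {poly F}) x :
  root (map_poly emb p) x -> size p = (deg x).+1 -> irreducible_poly p.
Proof.
move=> px sz_p; have p0 : p != 0 by rewrite -size_poly_eq0 sz_p.
split=> [|r sz_r r_p]; first by rewrite sz_p ltnS deg_gt0.
have [s def_p] : exists s, p = s * r by exists (p %/ r); rewrite divpK.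
move: p0 px; rewrite def_p mulf_eq0 negb_or => /andP[s0 r0].
rewrite rmorphM rootM => /orP[] /deg_root_emb_le lt_deg.
  have := lt_deg s0; rewrite -sz_p def_p size_mul //.
  have /eqP sz_r1 : size r != 1%N := sz_r.
  rewrite -size_poly_gt0 in r0 => s_ge.
  by exfalso; move: sz_r1 r0 s_ge; set a := size r; set b := size s; clearbody a b; clear; lia.
rewrite -dvdp_size_eqp ?dvdp_mull // eqn_leq dvdp_leq ?mulf_neq0 ?dvdp_mull //=.
by rewrite -def_p sz_p; apply: lt_deg.
Qed.

(** X^(q^d) - X is separable, its derivative being -1. *)
Lemma card_Fix d : (0 < d)%N ->
    (exists rs : seq E, 'X^(q ^ d) - 'X %= \prod_(r <- rs) ('X - r%:P)) ->
  #|Fix d| = (q ^ d)%N.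
Proof.
move=> d_gt0 [rs rsP].
have qd_gt1 : (1 < q ^ d)%N by rewrite -(exp1n d) ltn_exp2r // finNzRing_gt1.
have sz : size ('X^(q ^ d) - 'X : {poly E}) = (q ^ d).+1.
  by rewrite size_polyDl ?size_polyXn // size_polyN size_polyX.
have rs_uniq : uniq rs.
  rewrite -separable_prod_XsubC -(eqp_separable rsP) separable_poly.unlock.
  rewrite derivB derivXn derivX -mulr_natr -polyC_natr.
  have /eqP-> : (q ^ d)%:R == 0 :> E.
    apply: contraLR qd_gt1 => qd0; rewrite -leqNgt.
    by rewrite (pnat_1 (pchar_card_nat d)) // pcharf'_nat.
  by rewrite mulr0 sub0r -[X in coprimep _ X]scaleN1r coprimepZr ?oppr_eq0 ?oner_eq0 // coprimep1.
have X0 : 'X^(q ^ d) - 'X != 0 :> {poly E} by rewrite -size_poly_eq0 sz.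
have -> : #|Fix d| = size rs.
  rewrite -(card_uniqP rs_uniq); apply: eq_card => x.
  rewrite inE -root_prod_XsubC -(eqp_root rsP) /root !hornerE.
  by rewrite subr_eq0.
by move/eqp_size: rsP; rewrite sz size_prod_XsubC => -[].
Qed.

End Frobenius.

(** * Values missed by a cubic over a finite field *)

(** Every fibre of a monic cubic is a fibre of one without constant term. *)
Definition cubic (R : pzRingType) (a b y : R) := y ^+ 3 + a * y ^+ 2 + b * y.

(** The divided difference of the cubic, see [cubicB]. *)
Definition conic (R : pzRingType) (a b y z : R) :=
  y ^+ 2 + y * z + z ^+ 2 + a * (y + z) + b.

Lemma cubicB (R : comPzRingType) (a b y z : R) :
  cubic a b y - cubic a b z = (y - z) * conic a b y z.
Proof. by rewrite /cubic /conic; ring. Qed.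

Section CubicCount.

Variables (E : finFieldType) (K : divringClosed E).

Definition missed (a b : E) :=
  [set g | (g \in K) && ~~ [exists (y | y \in K), cubic a b y == g]].
(** That is, cubic a b X - cubic a b y = (X - y)^3. *)
Definition triple (a b y : E) := (a == - (3 * y)) && (b == 3 * y ^+ 2).
Definition conic_fiber (a b y : E) := [set z | (z \in K) && (conic a b y z == 0)].

(** A cubic whose fibre over g splits as (X - r)(X - s)(X - t). *)
Section Fiber.
Variables (r s t : E) (rK : r \in K) (sK : s \in K) (tK : t \in K).
Let a := - (r + s + t).
Let b := r * s + r * t + s * t.
Let g := r * s * t.

Lemma cubic_roots y : cubic a b y - g = (y - r) * (y - s) * (y - t).
Proof. by rewrite /cubic /a /b /g; ring. Qed.

Lemma cubic_rootsP y : (cubic a b y == g) = (y \in [set r; s; t]).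
Proof.
by rewrite -subr_eq0 cubic_roots !mulf_eq0 !subr_eq0 !inE.
Qed.

Lemma card_conic_fiber_root : #|conic_fiber a b r| = (s != t).+1.
Proof.
rewrite -cards2; apply: eq_card => v; rewrite !inE.
have -> : conic a b r v = (v - s) * (v - t) by rewrite /conic /a /b; ring.
rewrite mulf_eq0 !subr_eq0; case: eqP => [->|_]; first by rewrite sK.
by case: eqP => [->|]; rewrite ?tK ?andbF.
Qed.

Lemma triple_root : triple a b r = (r == s) && (r == t).
Proof.
apply/andP/andP => [[/eqP ha /eqP hb]|[/eqP rs /eqP rt]]; last first.
  by split; apply/eqP; rewrite /a /b -rs -rt; ring.
have rt : t = 2 * r - s.
  have h : - a = 3 * r by rewrite ha opprK.
  by transitivity (- a - r - s); [rewrite /a; ring | rewrite h; ring].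
have /eqP : (r - s) ^+ 2 = 0.
  by transitivity (3 * r ^+ 2 - b); [rewrite /b rt; ring | rewrite hb subrr].
rewrite expf_eq0 /= subr_eq0 => /eqP rs.
by rewrite rt -rs; split=> //; apply/eqP; ring.
Qed.
End Fiber.

Lemma fiber_count_split (a b g r s t : E) :
    r \in K -> s \in K -> t \in K ->
    a = - (r + s + t) -> b = r * s + r * t + s * t -> g = r * s * t ->
  (\sum_(y in [set r; s; t]) (3 + triple a b y) =
   3 + \sum_(y in [set r; s; t]) #|conic_fiber a b y|)%N.
Proof.
move=> rK sK tK aE bE gE.
have nr : #|conic_fiber a b r| = (s != t).+1.
  by rewrite aE bE card_conic_fiber_root.
have ns : #|conic_fiber a b s| = (r != t).+1.
  rewrite -(card_conic_fiber_root s rK tK); congr #|conic_fiber _ _ s|.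
    by rewrite aE; ring.
  by rewrite bE; ring.
have nt : #|conic_fiber a b t| = (r != s).+1.
  rewrite -(card_conic_fiber_root t rK sK); congr #|conic_fiber _ _ t|.
    by rewrite aE; ring.
  by rewrite bE; ring.
have tr : triple a b r = (r == s) && (r == t) by rewrite aE bE triple_root.
have ts : triple a b s = (s == r) && (s == t).
  by rewrite -triple_root; congr (triple _ _ s); rewrite ?aE ?bE; ring.
have tt : triple a b t = (t == r) && (t == s).
  by rewrite -triple_root; congr (triple _ _ t); rewrite ?aE ?bE; ring.
have [rs|rs] := eqVneq r s; have [rt|rt] := eqVneq r t.
- by rewrite -rs -rt !setUid !big_set1 tr nr -rs -rt !eqxx.
- have -> : [set r; s; t] = r |: [set t] by rewrite -rs setUid.
  by rewrite !big_setU1 ?inE // !big_set1 tr tt nr nt -rs !eqxx rt ![t == _]eq_sym (negPf rt) /=.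
- have -> : [set r; s; t] = r |: [set s].
    by rewrite -rt setUAC setUid.
  by rewrite !big_setU1 ?inE // !big_set1 tr ts nr ns -rt !eqxx ![s == _]eq_sym (negPf rs) /=.
have [st|st] := eqVneq s t.
  have -> : [set r; s; t] = r |: [set s] by rewrite -st -setUA setUid.
  by rewrite !big_setU1 ?inE // !big_set1 tr ts nr ns -st !eqxx ![s == r]eq_sym (negPf rs) /=.
have -> : [set r; s; t] = r |: (s |: [set t]) by rewrite setUA.
rewrite !big_setU1 ?inE ?negb_or ?rs ?rt ?st // !big_set1 tr ts tt nr ns nt.
by rewrite ![s == r]eq_sym ![t == _]eq_sym (negPf rs) (negPf rt) (negPf st).
Qed.

(** A fibre with two roots in K, counted with multiplicity, has all three roots
    in K, so there are five cases. Empty fibre: 3 + 0 = 3 + 0. A single simple root: 3 = 3 + 0. A triple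
    root: 3 + 1 = 3 + 1. A double and a simple root: 6 = 3 + 3. Three simple
    roots: 9 = 3 + 6. *)
Lemma fiber_count (a b g : E) : a \in K -> b \in K ->
  (3 * ~~ [exists (y | y \in K), cubic a b y == g] +
     \sum_(y in K | cubic a b y == g) (3 + triple a b y) =
   3 + \sum_(y in K | cubic a b y == g) #|conic_fiber a b y|)%N.
Proof.
move=> aK bK.
case: (boolP [exists (y | y \in K), cubic a b y == g]) => [|none]; last first.
  by rewrite !big_pred0 // => y; apply: contraNF none => /andP[yK yg];
    apply/exists_inP; exists y.
case/exists_inP=> r rK /eqP rg; rewrite muln0 add0n.
case: (boolP [exists (z | z \in K), conic a b r z == 0]); last first.
  move=> no_z; have only_r y : (y \in K) && (cubic a b y == g) = (y == r).
    apply/andP/eqP => [[yK /eqP yg]|->]; last by rewrite rg eqxx.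
    (* a second root in K would give a point z = y on the conic *)
    apply/eqP; apply: contraR no_z => y_r; apply/exists_inP; exists y => //.
    have /eqP : (r - y) * conic a b r y = 0 by rewrite -cubicB rg yg subrr.
    by rewrite mulf_eq0 subr_eq0 eq_sym (negPf y_r).
  rewrite !(eq_bigl _ _ only_r) !big_pred1_eq.
  have -> : triple a b r = false.
    apply: contraNF no_z => /andP[/eqP-> /eqP->]; apply/exists_inP; exists r => //.
    by apply/eqP; rewrite /conic; ring.
  suff -> : #|conic_fiber a b r| = 0%N by [].
  apply/eqP; rewrite cards_eq0; apply/eqP/setP => z; rewrite !inE.
  by apply: contraNF no_z => /andP[zK z0]; apply/exists_inP; exists z.
(* t is the third root, found from the sum of the roots *)
case/exists_inP => s sK /eqP rs0; pose t := - a - r - s.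
have tK : t \in K by rewrite !rpredB ?rpredN.
have aE : a = - (r + s + t) by rewrite /t; ring.
have bE : b = r * s + r * t + s * t.
  by rewrite -[LHS]subr0 -rs0 /conic /t; ring.
have gE : g = r * s * t.
  by apply/eqP; rewrite -rg aE bE cubic_rootsP !inE eqxx.
have yP y : (y \in K) && (cubic a b y == g) = (y \in [set r; s; t]).
  rewrite gE aE bE cubic_rootsP !inE; case: eqP => [->|_]; first by rewrite rK.
  by case: eqP => [->|_]; [rewrite sK | case: eqP => [->|]; rewrite ?tK ?andbF].
by rewrite !(eq_bigl _ _ yP); apply: fiber_count_split gE.
Qed.

(** The sum of [fiber_count] over all values g in K. The fibres partition K, so
    the terms 3 * #|fibre| and 3 add up to 3 * #|K| on both sides. *)
Lemma count_missed (a b : E) : a \in K -> b \in K ->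
  (3 * #|missed a b| + \sum_(y in K) triple a b y =
   \sum_(y in K) #|conic_fiber a b y|)%N.
Proof.
move=> aK bK.
have cK y : y \in K -> cubic a b y \in K.
  by move=> yK; rewrite /cubic !rpredD ?rpredM ?rpredX.
have byFiber (f : E -> nat) : (\sum_(y in K) f y =
    \sum_(g in K) \sum_(y in K | cubic a b y == g) f y)%N.
  exact: partition_big.
apply/eqP; rewrite -(eqn_add2l (3 * #|K|)); apply/eqP.
transitivity (\sum_(g in K) (3 * ~~ [exists (y | y \in K), cubic a b y == g] +
     \sum_(y in K | cubic a b y == g) (3 + triple a b y)))%N.
  rewrite big_split /= -byFiber [X in (_ = _ + X)%N]big_split /= sum_nat_const -big_distrr /=.
  rewrite [X in (_ = 3 * X + _)%N](_ : _ = #|missed a b|); last first.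
    rewrite -sum1_card big_mkcond /= [RHS]big_mkcond; apply: eq_bigr => g _.
    by rewrite inE; case: (g \in K) => //=; case: ifP.
  by rewrite mulnC addnCA addnA.
under eq_bigr => g _ do rewrite fiber_count //.
by rewrite big_split /= -byFiber sum_nat_const mulnC.
Qed.

End CubicCount.

(** * Points on the conic attached to a cubic *)

(** Turns upper bounds on all terms and the value of the sum into the value of
    each term; it spares the construction of explicit points on the conics. *)
Lemma sum_saturated (I : finType) (P : pred I) (f : I -> nat) (U : nat) :
    (forall i, P i -> f i <= U)%N -> (\sum_(i | P i) f i = #|P| * U)%N ->
  forall i, P i -> f i = U.
Proof.
move=> f_le f_sum i Pi.
have leif i0 : P i0 -> (f i0 <= U ?= iff (f i0 == U))%N.
  by move=> Pi0; split=> //; apply: f_le.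
have [_] := leqif_sum leif; rewrite f_sum sum_nat_const eqxx.
by move/esym/forall_inP/(_ i Pi)/eqP.
Qed.

Section ConicCount.

Variables (E : finFieldType) (K : divringClosed E).

Definition conic_points (a b : E) :=
  [set p : E * E | [&& p.1 \in K, p.2 \in K & conic a b p.1 p.2 == 0]].

Lemma sum_conic_fiber a b :
  (\sum_(y in K) #|conic_fiber K a b y| = #|conic_points a b|)%N.
Proof.
under eq_bigr do rewrite -sum1_card.
rewrite pair_big_dep -[RHS]sum1_card; apply: eq_bigl => p.
by rewrite !inE.
Qed.

(** When w is a primitive cube root of unity this form is the norm of y - w z. *)
Definition norm_points (b : E) :=
  [set p : E * E | [&& p.1 \in K, p.2 \in K & p.1 ^+ 2 + p.1 * p.2 + p.2 ^+ 2 == b]].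

(** Completing the square: the centre of the conic is moved to the origin by
    adding a / 3 to both coordinates. *)
Lemma card_conic_points a b : (3 : E) != 0 -> a \in K ->
  #|conic_points a b| = #|norm_points (a ^+ 2 / 3 - b)|.
Proof.
move=> n3 aK; pose s := a / 3.
have sK : s \in K by rewrite rpredM ?rpredV ?rpred_nat.
pose f (p : E * E) := (p.1 + s, p.2 + s).
have f_inj : injective f by move=> [? ?] [? ?] [/addIr-> /addIr->].
rewrite -[RHS](card_preimset _ f_inj); apply: eq_card => p.
rewrite !inE /= !(rpredDr _ sK); congr [&& _, _ & _].
rewrite -[RHS]subr_eq0; congr (_ == 0); rewrite /conic.
by rewrite /s; field; exact: n3.
Qed.

Lemma sum_norm_points : (\sum_(b in K) #|norm_points b| = #|K| ^ 2)%N.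
Proof.
have -> : (#|K| ^ 2 = #|setX [set x in K] [set x in K]|)%N by rewrite cardsX !cardsE.
rewrite -sum1_card (partition_big (fun p : E * E => p.1 ^+ 2 + p.1 * p.2 + p.2 ^+ 2) (mem K)) /=.
  apply: eq_bigr => b bK; rewrite -sum1_card; apply: eq_bigl => p.
  by rewrite !inE andbA.
by move=> p; rewrite !inE => /andP[p1 p2]; rewrite !rpredD ?rpredX ?rpredM.
Qed.

Lemma card_nonzero : #|[pred b in K | b != 0]| = #|K|.-1.
Proof.
rewrite (cardD1 0 K) rpred0 add1n /=; apply: eq_card => x.
by rewrite !inE andbC.
Qed.

Lemma sum_norm_points_neq0 :
  (\sum_(b in K | b != 0%R) #|norm_points b| = #|K| ^ 2 - #|norm_points 0%R|)%N.
Proof.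
by rewrite -sum_norm_points [in RHS](bigD1 (0 : E)) ?rpred0 //= addKn.
Qed.

Variable w : E.
Hypotheses (wP : w ^+ 2 + w + 1 = 0) (n3 : (3 : E) != 0).

Lemma norm_factor (y z : E) :
  y ^+ 2 + y * z + z ^+ 2 = (y - w * z) * (y - (- 1 - w) * z).
Proof.
transitivity (y ^+ 2 + y * z + z ^+ 2 - (w ^+ 2 + w + 1) * z ^+ 2); last by ring.
by rewrite wP mul0r subr0.
Qed.

(** The difference of the two cube roots of unity has square -3. *)
Lemma omega_neq : w != - 1 - w.
Proof.
apply: contraNneq n3 => wE; rewrite -oppr_eq0; apply/eqP.
transitivity ((w - (- 1 - w)) ^+ 2 - 4 * (w ^+ 2 + w + 1)); first by ring.
by rewrite wP -wE subrr; ring.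
Qed.

(** With w in K the form is a product of two independent linear forms. For
    b = 0 this gives two lines that meet in one point. For b != 0 the first
    form takes a nonzero value, which determines the second, so there are at
    most #|K| - 1 points; these bounds add up to the number of pairs outside
    the two lines. *)
Lemma card_norm_points_split : w \in K ->
  #|norm_points 0| = (2 * #|K|).-1 /\
  forall b, b \in K -> b != 0 -> #|norm_points b| = #|K|.-1.
Proof.
move=> wK; have w'K : - 1 - w \in K by rewrite rpredB ?rpredN1.
have K_gt0 : (0 < #|K|)%N by apply/card_gt0P; exists 0; apply: rpred0.
have card0 : #|norm_points 0| = (2 * #|K|).-1.
  pose line u := [set (u * z, z) | z in K].
  have card_line u : #|line u| = #|K| by rewrite card_imset // => x y [].
  have lineP u p : (p \in line u) = (p.2 \in K) && (p.1 == u * p.2).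
    apply/imsetP/andP => [[z zK ->]|[p2 /eqP p1]] /=; first by rewrite zK eqxx.
    by exists p.2 => //; rewrite -p1 -surjective_pairing.
  have -> : norm_points 0 = line w :|: line (- 1 - w).
    apply/setP => p; rewrite in_setU !lineP inE norm_factor mulf_eq0 !subr_eq0 -andb_orr.
    case: (boolP (p.2 \in K)) => p2K; rewrite ?andbF //=.
    by apply/andb_idl => /orP[]/eqP->; apply: rpredM.
  rewrite cardsU !card_line (_ : _ :&: _ = [set (0, 0)]) ?cards1 ?addnn ?mul2n ?subn1 //.
  apply/setP => -[y z]; rewrite in_setI !lineP inE /= xpair_eqE.
  apply/andP/andP => [[/andP[_ /eqP->] /andP[_ /eqP eq_wz]]|[/eqP-> /eqP->]]; last first.
    by rewrite rpred0 !mulr0 eqxx.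
  have /eqP : (w - (- 1 - w)) * z = 0 by rewrite mulrBl eq_wz subrr.
  rewrite mulf_eq0 subr_eq0 (negPf omega_neq) /= => /eqP->.
  by rewrite mulr0 eqxx.
split=> // b bK b0.
apply: (@sum_saturated E [pred c in K | c != 0] (fun c => #|norm_points c|) _ _ _ b);
  last by rewrite !inE bK.
  move=> c /andP[cK c0]; rewrite -card_nonzero -[in leqRHS]cardsE.
  pose f (p : E * E) := p.1 - w * p.2.
  rewrite -(@card_in_imset _ _ f).
    apply/subset_leq_card/subsetP => _ /imsetP[p + ->]; rewrite !inE norm_factor.
    move=> /and3P[p1 p2 /eqP pc]; rewrite rpredB ?rpredM //=.
    by apply: contra_neq c0 => p0; rewrite -pc -/(f p) p0 mul0r.
  move=> [y z] [y' z']; rewrite !inE !norm_factor /=.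
  move=> /and3P[yK zK /eqP pc] /and3P[y'K z'K /eqP pc']; rewrite /f /= => eq_f.
  (* the second linear form equals c divided by the nonzero first one *)
  have eq_f' : y - (- 1 - w) * z = y' - (- 1 - w) * z'.
    have nz : y - w * z != 0 by apply: contra_neq c0 => p0; rewrite -pc p0 mul0r.
    by apply: (mulfI nz); rewrite pc eq_f pc'.
  have eq_z : z = z'.
    apply: (@mulfI _ (w - (- 1 - w))); first by rewrite subr_eq0 omega_neq.
    transitivity ((y - (- 1 - w) * z) - (y - w * z)); first by ring.
    by rewrite eq_f eq_f'; ring.
  by move: eq_f; rewrite eq_z => /addIr->.
rewrite (eq_bigl (fun b => (b \in K) && (b != 0))) //.
rewrite sum_norm_points_neq0 card0 card_nonzero.
by rewrite -mulnn; case: #|K| K_gt0 => // k _; lia.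
Qed.

(** With w outside K the pair (y, z) is determined by u = y - w z, and the form
    is the norm u^(#|K| + 1). So there are at most #|K| + 1 points for b != 0,
    and these bounds add up to the #|K|^2 - 1 nonzero pairs. *)
Lemma card_norm_points_inert (psi : {rmorphism E -> E}) :
    (forall x, psi x = x ^+ #|K|) -> (forall x, (x \in K) = (psi x == x)) ->
    w \notin K ->
  #|norm_points 0| = 1%N /\
  forall b, b \in K -> b != 0 -> #|norm_points b| = #|K|.+1.
Proof.
move=> psiE psiK wNK.
have K_gt0 : (0 < #|K|)%N by apply/card_gt0P; exists 0; apply: rpred0.
have psi_w : psi w = - 1 - w.
  have /eqP : psi (w ^+ 2 + w + 1) = 0 by rewrite wP rmorph0.
  rewrite !rmorphD rmorph1 rmorphXn /= => /eqP psiP.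
  have /eqP : (psi w - w) * (psi w - (- 1 - w)) = 0.
    transitivity (psi w ^+ 2 + psi w + 1 - (w ^+ 2 + w + 1)); first by ring.
    by rewrite psiP wP subrr.
  by rewrite mulf_eq0 !subr_eq0 -psiK (negPf wNK) /= => /eqP.
pose f (p : E * E) := p.1 - w * p.2.
have f_inj c : {in norm_points c &, injective f}.
  move=> [y z] [y' z']; rewrite !inE /f /= => /and3P[yK zK _] /and3P[y'K z'K _] eq_f.
  have eq_z : z = z'.
    apply/eqP; rewrite -subr_eq0; apply: contraNT wNK => nz.
    rewrite (_ : w = (y - y') / (z - z')) ?rpred_div ?rpredB //.
    apply: (mulIf nz); rewrite divfK //.
    transitivity (y - (y - w * z) - w * z'); first by ring.
    by rewrite eq_f; ring.
  by move: eq_f; rewrite eq_z => /addIr->.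
have f_norm c p : p \in norm_points c -> f p ^+ #|K|.+1 = c.
  rewrite inE norm_factor => /and3P[]; rewrite psiK => /eqP p1; rewrite psiK => /eqP p2 /eqP <-.
  by rewrite exprS -psiE rmorphB rmorphM /= p1 p2 psi_w.
have card0 : #|norm_points 0| = 1%N.
  rewrite -(cards1 (0 : E)) -(card_in_imset (f_inj 0)); apply: eq_card => x.
  rewrite !inE; apply/imsetP/eqP => [[p /f_norm /eqP + ->]|->].
    by rewrite expf_eq0 /= => /eqP.
  by exists (0, 0); rewrite ?inE /f /= ?rpred0 ?mulr0 ?subrr // expr0n /= !addr0.
split=> // b bK b0.
apply: (@sum_saturated E [pred c in K | c != 0] (fun c => #|norm_points c|) _ _ _ b);
  last by rewrite !inE bK.
  move=> c /andP[cK c0]; rewrite -(card_in_imset (f_inj c)) -ltnS.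
  rewrite -(size_XnsubC c (ltn0Sn _)) cardE; apply: max_poly_roots (enum_uniq _).
    by rewrite -size_poly_eq0 size_XnsubC.
  apply/allP => x; rewrite mem_enum => /imsetP[p pc ->].
  by rewrite /root !hornerE (f_norm c) // subrr.
rewrite (eq_bigl (fun b => (b \in K) && (b != 0))) //.
rewrite sum_norm_points_neq0 card0 card_nonzero.
by rewrite -mulnn; case: #|K| K_gt0 => // k _; lia.
Qed.

End ConicCount.

(** * Totals over all cubics with coefficients in F *)

Section Totals.

Variables (F E : finFieldType) (emb : {rmorphism F -> E}) (d : nat).
Hypothesis card_K : #|Fix emb d| = (#|F| ^ d)%N.
Local Notation q := #|F|.
Local Notation Q := (q ^ d)%N.
Local Notation K := (Fix emb d).

Definition total_missed :=
  (\sum_(a : F) \sum_(b : F) #|missed K (emb a) (emb b)|)%N.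

Lemma total_missedE :
  (3 * total_missed + \sum_(a : F) \sum_(b : F) \sum_(y in K) triple (emb a) (emb b) y =
   \sum_(a : F) \sum_(b : F) #|conic_points K (emb a) (emb b)|)%N.
Proof.
rewrite big_distrr -big_split /=; apply: eq_bigr => a _.
rewrite big_distrr -big_split /=; apply: eq_bigr => b _.
by rewrite -sum_conic_fiber count_missed ?Fix_emb.
Qed.

Lemma sum_const_nonzero (f : F -> nat) k :
  (forall b, b != 0 -> f b = k) -> (\sum_b f b = f 0%R + q.-1 * k)%N.
Proof.
move=> fE; rewrite (bigD1 (0 : F)) //=; congr (_ + _)%N.
rewrite (eq_bigr (fun=> k)) // sum_nat_const; congr (_ * _)%N.
by rewrite -(cardC1 (0 : F)).
Qed.

Section NotThree.
Hypothesis n3 : (3 : F) != 0.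
Let n3E : (3 : E) != 0.
Proof. by rewrite -(rmorph_nat emb) fmorph_eq0. Qed.

(** For each a exactly one b makes the cubic a cube (X + a / 3)^3 up to a
    constant, and then the triple root is - a / 3. *)
Lemma sum_triple a : (\sum_(b : F) \sum_(y in K) triple (emb a) (emb b) y = 1)%N.
Proof.
rewrite (bigD1 (a ^+ 2 / 3)) //= [X in (_ + X)%N]big1 => [|b b_neq]; last first.
  apply: big1 => y _; rewrite /triple; case: andP => // -[/eqP ha /eqP hb].
  case/eqP: b_neq; apply: (fmorph_inj emb).
  by rewrite fmorph_div rmorphXn /= ha hb rmorph_nat; field.
rewrite addn0 (bigD1 (emb (- a / 3))) ?Fix_emb //= big1 => [|y /andP[_ y_neq]].
  rewrite /triple addn0 !fmorph_div !rmorphN rmorphXn rmorph_nat.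
  rewrite (_ : (_ == _) = true); last by apply/eqP; field.
  by rewrite (_ : (_ == _) = true) //; apply/eqP; field.
rewrite /triple; case: andP => // -[/eqP ha _]; case/eqP: y_neq.
by rewrite fmorph_div rmorphN ha rmorph_nat opprK; field.
Qed.

(** As b runs through F so does a^2 / 3 - b. *)
Lemma sum_conic_norm a :
  (\sum_(b : F) #|conic_points K (emb a) (emb b)| =
   \sum_(b : F) #|norm_points K (emb b)|)%N.
Proof.
rewrite [RHS](reindex_inj (inv_inj (subKr (a ^+ 2 / 3)))) /=.
apply: eq_bigr => b _; rewrite card_conic_points ?Fix_emb //.
by rewrite rmorphB fmorph_div rmorphXn rmorph_nat.
Qed.

Lemma total_missed_norm k : (forall b : F, b != 0 -> #|norm_points K (emb b)| = k) ->
  (3 * total_missed + q = q * (#|norm_points K 0%R| + q.-1 * k))%N.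
Proof.
move=> norm_k; have := total_missedE.
under eq_bigr do rewrite sum_triple.
under [RHS]eq_bigr do rewrite sum_conic_norm (sum_const_nonzero norm_k) rmorph0.
by rewrite sum1_card sum_nat_const.
Qed.

Variable w : E.
Hypothesis wP : w ^+ 2 + w + 1 = 0.

Lemma total_missed_split : w \in K -> (3 * total_missed = q * (q.+1 * Q.-1))%N.
Proof.
move=> wK; have [n0 n1] := card_norm_points_split wP n3E wK.
have norm1 b : b != 0 -> #|norm_points K (emb b)| = Q.-1.
  by move=> b0; rewrite n1 ?Fix_emb ?fmorph_eq0 // card_K.
have := total_missed_norm norm1; rewrite n0 card_K.
have q_gt0 : (0 < q)%N := ltnW (finNzRing_gt1 F).
have Q_gt0 : (0 < Q)%N by rewrite expn_gt0 q_gt0.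
case: (q ^ d)%N Q_gt0 => // k _; case: q q_gt0 => // n _ /=; lia.
Qed.

Lemma total_missed_inert : (0 < d)%N -> w \notin K ->
  (3 * total_missed = q * (q.-1 * Q.+1))%N.
Proof.
move=> d_gt0 wK.
have [||n0 n1] := card_norm_points_inert wP n3E (psi := frob emb d) _ _ wK.
- by move=> x; rewrite card_K.
- by move=> x.
have norm1 b : b != 0 -> #|norm_points K (emb b)| = Q.+1.
  by move=> b0; rewrite n1 ?Fix_emb ?fmorph_eq0 // card_K.
have := total_missed_norm norm1; rewrite n0.
have q_gt0 : (0 < q)%N := ltnW (finNzRing_gt1 F).
case: q q_gt0 => // n _ /=; lia.
Qed.

(** The power q^d fixes an element of multiplicative order 3 only when it is
    congruent to 1 modulo 3. *)
Lemma omega_Fix : (w \in K) = (Q %% 3 == 1)%N.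
Proof.
have w3 : w ^+ 3 = 1.
  apply/eqP; rewrite -subr_eq0; apply/eqP.
  by transitivity ((w - 1) * (w ^+ 2 + w + 1)); [ring | rewrite wP mulr0].
have w1 : w != 1.
  by apply: contra_neq n3E => w1; rewrite -wP w1; ring.
have w0 : w != 0 by apply: contra_eq_neq wP => ->; rewrite expr0n /= !add0r oner_eq0.
rewrite inE /frob [in LHS](divn_eq Q 3) exprD mulnC exprM w3 expr1n mul1r.
have := ltn_pmod Q (isT : 0 < 3)%N; case: (Q %% 3)%N => [|[|[|]]] // _.
- by rewrite eq_sym (negPf w1).
- by rewrite expr1 !eqxx.
- by rewrite expr2 -[eqbRHS]mulr1 (inj_eq (mulfI w0)) (negPf w1).
Qed.

End NotThree.

Section Three.
Hypothesis E3 : (3 : E) = 0.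

(** In characteristic 3 the quadratic part degenerates to a square. *)
Lemma conic3E (a b y z : E) : conic a b y z = (y - z) ^+ 2 + a * (y + z) + b.
Proof.
transitivity ((y - z) ^+ 2 + a * (y + z) + b + 3 * (y * z)).
  by rewrite /conic; ring.
by rewrite E3 mul0r addr0.
Qed.

(** The conic is a parabola: v = y - z determines y + z and thus, as 2 is
    invertible, the point. *)
Lemma card_conic_points3 a b : a \in K -> a != 0 -> b \in K -> #|conic_points K a b| = #|K|.
Proof.
move=> aK a0 bK.
pose f (v : E) := let s := - (v ^+ 2 + b) / a in (- (v + s), - (v + s) - v).
have f_inj : injective f by move=> u v [/oppr_inj h1 h2]; move: h2; rewrite h1 => /addrI/oppr_inj.
rewrite -[RHS](card_imset _ f_inj); apply: eq_card => -[y z]; rewrite inE /=.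
apply/and3P/imsetP => [[yK zK /eqP]|[v vK [-> ->]]].
  rewrite conic3E => yz; exists (y - z); first exact: rpredB.
  have -> : f (y - z) = (- (y - z + (y + z)), - (y - z + (y + z)) - (y - z)).
    rewrite /f; suff -> : - ((y - z) ^+ 2 + b) / a = y + z by [].
    apply: (mulIf a0); rewrite divfK //; apply/eqP; rewrite -subr_eq0; apply/eqP.
    transitivity (- ((y - z) ^+ 2 + a * (y + z) + b)); first by ring.
    by rewrite yz oppr0.
  congr (_, _).
    transitivity (- (y - z + (y + z)) + 3 * y); first by ring.
    by rewrite E3 mul0r addr0.
  transitivity (- (y - z + (y + z)) - (y - z) + 3 * y); first by ring.
  by rewrite E3 mul0r addr0.
have sK : - (v ^+ 2 + b) / a \in K by rewrite rpred_div ?rpredN ?rpredD ?rpredX.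
split; rewrite ?rpredB ?rpredN ?rpredD //.
rewrite conic3E; apply/eqP; set s := _ / a.
transitivity (s * a + v ^+ 2 + b - 3 * (a * (s + v))); first by ring.
by rewrite E3 mul0r subr0 /s divfK //; ring.
Qed.

(** With a = 0 only y - z is constrained, and y is free. *)
Lemma card_conic_points3_0 b :
  #|conic_points K 0 b| = (#|K| * #|[pred v in K | v ^+ 2 == - b]|)%N.
Proof.
pose G := [set v in K | v ^+ 2 == - b].
have -> : #|[pred v in K | v ^+ 2 == - b]| = #|G|.
  by apply: eq_card => v; rewrite !inE.
rewrite -[#|K|]cardsE -cardsX.
pose f (p : E * E) := (p.1, p.1 - p.2).
have f_inj : injective f by move=> [? ?] [? ?] [-> /addrI/oppr_inj->].
rewrite -[RHS](card_preimset _ f_inj); apply: eq_card => -[y z].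
rewrite inE [RHS]inE in_setX !in_set /= conic3E mul0r addr0 addr_eq0.
by apply/and3P/and3P => -[yK zK ->]; split=> //; rewrite ?rpredB // -(rpredBl _ yK).
Qed.

Lemma sum_card_conic_points3 :
  (\sum_(b : F) #|conic_points K 0%R (emb b)| =
   #|K| * #|[pred v in K | v ^+ 2 \in Fix emb 1]|)%N.
Proof.
under eq_bigr do rewrite card_conic_points3_0.
rewrite -big_distrr /=; congr (_ * _)%N.
transitivity (\sum_(b : F) \sum_(v in K) (v ^+ 2 == - emb b))%N.
  apply: eq_bigr => b _; rewrite -sum1_card big_mkcond [RHS]big_mkcond.
  by apply: eq_bigr => v _; rewrite [in LHS]inE /=; case: (v \in K) => //=; case: eqP.
rewrite exchange_big -sum1_card big_mkcond [RHS]big_mkcond; apply: eq_bigr => v _.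
rewrite [in RHS]inE /=; case: (v \in K) => //=.
case: ifPn => [/Fix1P[b vb]|v2].
  rewrite (bigD1 (- b)) //= rmorphN opprK vb eqxx big1 // => c c_b.
  case: eqP => // v_c; case/eqP: c_b; apply: (fmorph_inj emb).
  by rewrite rmorphN vb v_c opprK.
by rewrite big1 // => b _; case: eqP => // vb; rewrite vb -rmorphN Fix_emb in v2.
Qed.

Hypothesis sqrtE : forall a : F, exists r : E, r ^+ 2 = emb a.

(** A square root of an element of F has degree 1 or 2. For odd d only those
    in F lie in Fix d; for even d all of them do, and each nonzero element of F
    has two. *)
Lemma card_square_Fix : (0 < d)%N ->
  #|[pred v in K | v ^+ 2 \in Fix emb 1]| = (1 + q.-1 * (1 + ~~ odd d))%N.
Proof.
move=> d_gt0.
have n2 : (2 : E) != 0.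
  apply/eqP => E2; have /eqP := oner_neq0 E; apply; transitivity (3 - 2 : E); first by ring.
  by rewrite E2 E3 subrr.
have v_deg v : v ^+ 2 \in Fix emb 1 -> (deg emb v %| 2)%N.
  rewrite FixE -!frob_fixE rmorphXn /= -subr_eq0 subr_sqr mulf_eq0 subr_eq0 addr_eq0.
  rewrite (frobD_exp emb 1 1).
  by case/orP=> /eqP fv; rewrite fv ?rmorphN /= fv ?opprK.
have q_gt0 : (0 < q)%N := ltnW (finNzRing_gt1 F).
case: (boolP (odd d)) => d_odd /=.
  rewrite addn0 muln1 add1n prednK // -(card_imset predT (fmorph_inj emb)).
  apply: eq_card => v; apply/idP/imsetP => [|[a _ ->]]; rewrite inE /=.
    case/andP=> vK v2; have [|a <-] := @Fix1P _ _ emb v; last by exists a.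
    have : (deg emb v %| gcdn 2 d)%N by rewrite dvdn_gcd v_deg // -FixE.
    by rewrite FixE (eqP (_ : coprime 2 d)) // coprime2n.
  by rewrite -rmorphXn !Fix_emb.
have -> : #|[pred v in K | v ^+ 2 \in Fix emb 1]| =
          (\sum_(a : F) #|[set v : E | v ^+ 2 == emb a]|)%N.
  rewrite -sum1_card (partition_big (fun v => odflt 0 [pick a | emb a == v ^+ 2]) xpredT) //=.
  apply: eq_bigr => a _; rewrite -sum1_card; apply: eq_bigl => v.
  rewrite [v \in pred_of_simpl _]inE /= in_set.
  apply/idP/eqP => [/andP[/andP[_ /Fix1P[b bv]]]|va].
    by case: pickP => [c /eqP cv /eqP<-|/(_ b)]; rewrite ?bv ?eqxx.
  have v2 : v ^+ 2 \in Fix emb 1 by rewrite va Fix_emb.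
  rewrite v2 FixE (dvdn_trans (v_deg _ v2)) ?dvdn2 // va /=.
  by case: pickP => [c /eqP/fmorph_inj->|/(_ a)]; rewrite ?eqxx.
rewrite (sum_const_nonzero (k := 2)) => [|a a0]; last first.
  have [r ra] := sqrtE a; rewrite -ra.
  have -> : [set v | v ^+ 2 == r ^+ 2] = [set r; - r].
    by apply/setP => v; rewrite in_set in_set2 eqf_sqr.
  rewrite cards2 -subr_eq0 opprK -mulr2n -mulr_natl mulf_eq0 (negPf n2) /=.
  by rewrite -(fmorph_eq0 emb) -ra expf_eq0 /= in a0; rewrite a0.
congr (_ + _)%N; rewrite rmorph0 -(cards1 (0 : E)); apply: eq_card => v.
by rewrite in_set in_set1 expf_eq0.
Qed.

(** For a != 0 there is no triple root and every conic has #|K| points. For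
    a = 0 the only cubic with triple roots is X^3, for which every root is
    triple. *)
Lemma total_missed3 : (0 < d)%N ->
  (3 * total_missed = q.-1 * (q + (1 + ~~ odd d)) * Q)%N.
Proof.
move=> d_gt0; have := total_missedE.
rewrite (sum_const_nonzero (k := 0)) => [|a a0]; last first.
  apply: big1 => b _; apply: big1 => y _.
  by rewrite /triple E3 mul0r oppr0 fmorph_eq0 (negPf a0).
rewrite rmorph0 (sum_const_nonzero (k := 0)) => [|b b0]; last first.
  by apply: big1 => y _; rewrite /triple E3 !mul0r oppr0 eqxx /= fmorph_eq0 (negPf b0).
rewrite rmorph0 (eq_bigr (fun=> 1%N)); last first.
  by move=> y _; rewrite /triple E3 !mul0r oppr0 !eqxx.
rewrite (sum_const_nonzero (k := q * Q)
  (f := fun a => (\sum_(b : F) #|conic_points K (emb a) (emb b)|)%N)).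
  rewrite rmorph0 sum_card_conic_points3 card_square_Fix // sum1_card card_K.
  have q_gt0 : (0 < q)%N := ltnW (finNzRing_gt1 F).
  by case: q q_gt0 => // n _ /=; lia.
move=> a a0; rewrite (eq_bigr (fun=> Q)) ?sum_nat_const // => b _.
by rewrite card_conic_points3 ?Fix_emb ?fmorph_eq0.
Qed.

End Three.
End Totals.

(** * Missed values of exact degree *)

Section Degree.

Variables (F E : finFieldType) (emb : {rmorphism F -> E}).
Local Notation phi := (frob emb).
Local Notation deg := (deg emb).
Local Notation Fix := (Fix emb).

Lemma deg_le_monic b k (c : nat -> E) x : (0 < b)%N -> (forall i, c i \in Fix b) ->
  x ^+ k = \sum_(i < k) c i * x ^+ i -> (deg x <= k * b)%N.
Proof.
move=> b_gt0 cK xk; pose p := 'X^k - \poly_(i < k) c i.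
have sz_p : size p = k.+1.
  by rewrite size_polyDl ?size_polyXn // size_polyN ltnS size_poly.
rewrite -[k]/(k.+1.-1) -sz_p; apply: deg_root_le => //.
- by rewrite -size_poly_eq0 sz_p.
- rewrite rmorphB /= map_polyXn; congr (_ - _); apply/polyP => i.
  by rewrite coef_map !coef_poly; case: ifP => _; rewrite ?raddf0 /= ?Fix_frob.
- by rewrite /root !hornerE horner_poly xk subrr.
Qed.

Lemma frob_cubic d (a b : F) y :
  phi d (cubic (emb a) (emb b) y) = cubic (emb a) (emb b) (phi d y).
Proof.
rewrite /cubic !rmorphD (rmorphM _ (emb a)) (rmorphM _ (emb b)) /= !frob_emb.
by rewrite !(rmorphXn (phi d)).
Qed.

Lemma deg_cubic (a b : F) y : (deg (cubic (emb a) (emb b) y) %| deg y)%N.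
Proof. by rewrite -frob_fixE frob_cubic frob_deg. Qed.

Lemma missedP (K : divringClosed E) (a b g : E) :
  reflect (g \in K /\ forall y, y \in K -> cubic a b y <> g) (g \in missed K a b).
Proof.
rewrite inE; apply: (iffP andP) => -[gK no_y]; split=> //.
  by move=> y yK yg; case/exists_inP: no_y; exists y => //; apply/eqP.
by apply/exists_inP => -[y yK /eqP]; apply: no_y.
Qed.

(** Frobenius phi d permutes the roots r, s = phi d r, t of the cubic without
    fixing any. It cannot exchange r and s, as it would then fix t, so it is a
    3-cycle and its cube fixes r. *)
Lemma missed_root_deg d (a b : F) (r : E) :
    cubic (emb a) (emb b) r \in missed (Fix d) (emb a) (emb b) ->
  (deg r %| 3 * d)%N.
Proof.
set g := cubic _ _ r => /missedP[gK no_root].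
have root_frob y : cubic (emb a) (emb b) y = g -> cubic (emb a) (emb b) (phi d y) = g.
  by move=> yg; rewrite -frob_cubic yg Fix_frob.
have not_fixed y : cubic (emb a) (emb b) y = g -> phi d y != y.
  by move=> yg; apply/negP => yK; apply: (no_root y).
pose s := phi d r; have sg : cubic (emb a) (emb b) s = g by apply: root_frob.
(* t is the third root, found from the sum of the roots *)
pose t := - emb a - r - s.
have rs : conic (emb a) (emb b) r s = 0.
  apply/eqP; have /eqP : (r - s) * conic (emb a) (emb b) r s = 0.
    by rewrite -cubicB sg subrr.
  by rewrite mulf_eq0 subr_eq0 eq_sym (negPf (not_fixed r _)).
have rootP y : (cubic (emb a) (emb b) y == g) = (y \in [set r; s; t]).
  have aE : emb a = - (r + s + t) by rewrite /t; ring.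
  have bE : emb b = r * s + r * t + s * t.
    by rewrite -[LHS]subr0 -rs /conic /t; ring.
  have gE : g = r * s * t.
    by apply/eqP; rewrite /g aE bE cubic_rootsP !inE eqxx.
  by rewrite gE aE bE cubic_rootsP.
have tg : cubic (emb a) (emb b) t = g by apply/eqP; rewrite rootP !inE eqxx !orbT.
have frob_t : phi d t = - emb a - s - phi d s.
  by rewrite /t !rmorphB rmorphN /= frob_emb.
have frob_s : phi d s = t.
  have /eqP := root_frob s sg; rewrite rootP !inE (negPf (not_fixed s sg)) orbF.
  case/orP=> /eqP // sr; case/eqP: (not_fixed t tg).
  by rewrite frob_t sr /t; ring.
rewrite -frob_fixE (_ : 3 * d = d + (d + d))%N; last by lia.
by rewrite !frobD_exp -/s frob_s frob_t frob_s /t; apply/eqP; ring.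
Qed.

(** The degree of r is a multiple of d that divides 3 d, and it is not d. *)
Lemma missed_degE d (a b : F) (r : E) (g := cubic (emb a) (emb b) r) :
  g \in missed (Fix d) (emb a) (emb b) -> deg g = d -> deg r = (3 * d)%N.
Proof.
move=> g_missed deg_g.
have := missed_root_deg g_missed; have := deg_cubic a b r.
rewrite -/g deg_g => /dvdnP[k def_r]; rewrite def_r.
have d_gt0 : (0 < d)%N by rewrite -deg_g deg_gt0.
rewrite dvdn_pmul2r // => k3; congr (_ * _)%N.
apply: (prime_nt_dvdP _ _ k3) => //; apply/eqP => k1.
have [_ /(_ r) no_root] := missedP _ _ _ _ g_missed.
by apply: no_root => //; rewrite FixE def_r k1 mul1n.
Qed.

(** A root z in Fix m would leave y as a root of a quadratic over Fix m. *)
Lemma deg3_missed m (a b : F) (y : E) (g := cubic (emb a) (emb b) y) :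
  deg g = m -> deg y = (3 * m)%N -> g \in missed (Fix m) (emb a) (emb b).
Proof.
move=> deg_g deg_y; apply/missedP; rewrite FixE deg_g dvdnn; split=> // z zK zg.
have m_gt0 : (0 < m)%N by rewrite -deg_g deg_gt0.
have : conic (emb a) (emb b) z y = 0.
  apply/eqP; have /eqP : (z - y) * conic (emb a) (emb b) z y = 0.
    by rewrite -cubicB zg subrr.
  rewrite mulf_eq0 subr_eq0 => /orP[/eqP zy|//].
  by move: zK; rewrite zy FixE deg_y => /dvdn_leq; lia.
(* the quadratic conic z Y = 0, as a monic equation for y *)
pose c i := - (if i == 0%N then z ^+ 2 + emb a * z + emb b else z + emb a).
move=> zy; have : (deg y <= 2 * m)%N.
  apply: (@deg_le_monic _ _ c) => // [i|].
    by rewrite rpredN; case: ifP; rewrite !rpredD ?rpredX ?rpredM ?Fix_emb.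
  rewrite !big_ord_recl big_ord0 /c /= !expr1 expr0.
  apply/eqP; rewrite -subr_eq0 addr0 -[eqbRHS]zy /conic; apply/eqP; ring.
by rewrite deg_y; lia.
Qed.

Section Decomposition.

Variables (m : nat) (m_gt0 : (0 < m)%N).
Hypothesis cubic_surj : forall (a b : F) g, g \in Fix m ->
  exists r, cubic (emb a) (emb b) r = g.

(** A value g of degree d that is missed over Fix d has its preimages in
    degree 3 d. They lie in Fix n exactly when 3 divides n / d. *)
Lemma missed_Fix (n : nat) (a b : F) (g : E) : (n %| m)%N -> g \in Fix n ->
  (g \in missed (Fix n) (emb a) (emb b)) =
  ~~ (3 %| n %/ deg g)%N && (g \in missed (Fix (deg g)) (emb a) (emb b)).
Proof.
move=> nm gn; have d_n : (deg g %| n)%N by rewrite -FixE.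
have n_gt0 : (0 < n)%N := dvdn_gt0 m_gt0 nm.
have [g_missed|g_hit] := boolP (g \in missed (Fix (deg g)) _ _); last first.
  rewrite andbF; apply: contraNF g_hit => /missedP[_ no_root]; apply/missedP.
  split=> [|y yK]; first by rewrite FixE.
  by apply: no_root; move: yK; rewrite !FixE => /dvdn_trans->.
have [r rg] : exists r, cubic (emb a) (emb b) r = g.
  by apply: cubic_surj; move: gn; rewrite !FixE => /dvdn_trans->.
have deg_r : deg r = (3 * deg g)%N.
  by have := @missed_degE (deg g) a b r; rewrite rg; apply.
have r_n : (deg r %| n)%N = (3 %| n %/ deg g)%N by rewrite dvdn_divRL // deg_r.
rewrite andbT -r_n; apply/missedP/idP => [[_ no_root]|rNn].
  by apply/negP; rewrite -FixE => rK; apply: (no_root r).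
split=> // y yK yg; move/negP: rNn; apply; rewrite deg_r.
rewrite -(@missed_degE (deg g) a b y) ?yg // -FixE //.
Qed.

Definition deg_missed d (a b : F) :=
  [set g | (deg g == d) && (g \in missed (Fix d) (emb a) (emb b))].

Lemma card_missed_split n (a b : F) : (n %| m)%N ->
  (#|missed (Fix n) (emb a) (emb b)| =
   \sum_(d <- divisors n | ~~ (3 %| n %/ d)) #|deg_missed d a b|)%N.
Proof.
move=> nm; have n_gt0 : (0 < n)%N := dvdn_gt0 m_gt0 nm.
rewrite -sum1_card big_mkcond.
transitivity (\sum_(d <- divisors n | ~~ (3 %| n %/ d))
  \sum_(g : E) (g \in deg_missed d a b))%N; last first.
  by apply: eq_bigr => d _; rewrite -sum1_card [RHS]big_mkcond; apply: eq_bigr => g _; case: ifP.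
rewrite exchange_big; apply: eq_bigr => g _ /=.
case: (boolP (g \in Fix n)) => [gn|gNn].
  have dn : deg g \in divisors n by rewrite -dvdn_divisors // -FixE.
  rewrite big_mkcond (bigD1_seq (deg g)) ?divisors_uniq //= big1 => [|d d_neq].
    rewrite addn0 missed_Fix // [g \in deg_missed _ _ _]inE eqxx /=.
    by case: (~~ _) => //=; case: ifP.
  by case: ifP => // _; rewrite inE eq_sym (negPf d_neq).
rewrite (_ : _ \in _ = false); last by apply: contraNF gNn => /missedP[].
rewrite big1_seq // => d /andP[_]; rewrite -dvdn_divisors // => dn.
by rewrite inE; case: eqP => // deg_g; rewrite FixE deg_g dn in gNn.
Qed.

(** [card_missed_split] is the restricted divisor sum to which
    [mobius_inversion_prime_to] applies with l = 3. *)
Lemma sum_deg_missed (R : pzRingType) :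
  (\sum_(a : F) \sum_(b : F) #|deg_missed m a b|)%:R =
  \sum_(e <- divisors m | ~~ (3 %| e)%N)
     (mobius e)%:~R * (total_missed emb (m %/ e)%N)%:R :> R.
Proof.
apply: (@mobius_inversion_prime_to _ 3 m (fun n => (total_missed emb n)%:R)
  (fun n => (\sum_(a : F) \sum_(b : F) #|deg_missed n a b|)%:R)) => // n nm.
rewrite -natr_sum /total_missed; congr (_%:R).
rewrite [RHS]exchange_big; apply: eq_bigr => a _ /=.
rewrite [RHS]exchange_big; apply: eq_bigr => b _ /=.
exact: card_missed_split.
Qed.

End Decomposition.
End Degree.

(** * Matrices with a prescribed eigenvalue *)

Section Krylov.

Variables (F : fieldType) (n : nat).
Implicit Types (A : 'M[F]_n.+1) (v : 'rV[F]_n.+1) (p : {poly F}).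

Definition krylov A v := \matrix_(i < n.+1) (v *m A ^+ i).

Lemma mul_krylov A v u : u *m krylov A v = v *m horner_mx A (rVpoly u).
Proof.
rewrite /rVpoly poly_def rmorph_sum mulmx_sumr mulmx_sum_row.
apply: eq_bigr => i _; rewrite rowK valK /=.
rewrite -mul_polyC rmorphM rmorphXn /= horner_mx_X horner_mx_C.
by rewrite -mulmxE mul_scalar_mx -scalemxAr.
Qed.

Lemma krylov_row0 A v : row 0 (krylov A v) = v.
Proof. by rewrite rowK expr0 mulmx1. Qed.

(** A relation among the rows is a polynomial p of degree at most n with
    v *m p(A) = 0. As p is prime to the irreducible characteristic polynomial,
    a Bezout identity and the Cayley-Hamilton theorem give v = 0. *)
Lemma krylov_unit A v : irreducible_poly (char_poly A) -> v != 0 ->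
  krylov A v \in unitmx.
Proof.
move=> A_irr v0; rewrite -row_free_unit; apply/inj_row_free => u uK.
pose p := rVpoly u; have sz_p : (size p <= n.+1)%N by apply: size_poly.
have vp : v *m horner_mx A p = 0 by rewrite -mul_krylov.
apply/eqP; apply: contraNT v0 => u0; have p0 : p != 0.
  by apply: contraNneq u0 => p0; rewrite -[u]rVpolyK -/p p0 linear0.
have : coprimep (char_poly A) p.
  rewrite irreducible_poly_coprime //; apply: contraTN sz_p => /dvdp_leq.
  by rewrite size_char_poly -ltnNge; apply.
case/Bezout_eq1_coprimepP => -[/= s t] bez; apply/eqP.
have -> : v = v *m horner_mx A 1 by rewrite rmorph1 mulmx1.
rewrite -bez rmorphD !rmorphM /= Cayley_Hamilton mulr0 add0r.
rewrite -(rmorphM (horner_mx A)) mulrC rmorphM /=.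
by rewrite -mulmxE mulmxA vp mul0mx.
Qed.

(** By Cayley-Hamilton, the vector v *m p(A) depends only on p modulo the
    characteristic polynomial and on the Krylov matrix, in particular for
    p = X^(i+1), which gives the rows of krylov A v *m A. *)
Lemma krylov_inj A B v : char_poly A = char_poly B -> krylov A v \in unitmx ->
  krylov A v = krylov B v -> A = B.
Proof.
move=> eq_char K_unit eq_K.
pose f := char_poly A; have f0 : f != 0 by rewrite monic_neq0 ?char_poly_monic.
have horner_mod C p : char_poly C = f ->
    v *m horner_mx C p = poly_rV (p %% f) *m krylov C v.
  move=> Cf; rewrite mul_krylov poly_rV_K; last first.
    by rewrite -ltnS -(size_char_poly A) ltn_modp.
  rewrite {1}(divp_eq p f) rmorphD rmorphM /= -Cf Cayley_Hamilton mulr0 add0r.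
  by [].
apply: (can_inj (mulKmx K_unit)); apply/row_matrixP => i.
rewrite [in RHS]eq_K !row_mul !rowK -!mulmxA !mulmxE -!exprSr.
rewrite -{1}(horner_mx_X A) -{1}(horner_mx_X B) -!rmorphXn /=.
by rewrite !horner_mod // eq_K.
Qed.

Lemma krylov_conj A v G : G \in unitmx -> v *m G = v ->
  krylov (invmx G *m A *m G) v = krylov A v *m G.
Proof.
move=> G_unit vG; have vG' : v *m invmx G = v by rewrite -{1}vG mulmxK.
have conjX i : (invmx G *m A *m G) ^+ i = invmx G *m A ^+ i *m G.
  elim: i => [|i IHi]; first by rewrite !expr0 mulmx1 mulVmx.
  rewrite exprSr IHi -mulmxE !mulmxA mulmxK //.
  by rewrite exprSr -mulmxE !mulmxA.
by apply/row_matrixP => i; rewrite row_mul !rowK conjX !mulmxA vG'.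
Qed.

Lemma char_poly_conj A G : G \in unitmx -> char_poly (invmx G *m A *m G) = char_poly A.
Proof.
move=> G_unit; rewrite /char_poly.
have -> : char_poly_mx (invmx G *m A *m G) =
    map_mx polyC (invmx G) *m char_poly_mx A *m map_mx polyC G.
  rewrite /char_poly_mx mulmxBr mulmxBl !map_mxM /=; congr (_ - _).
  by rewrite scalar_mxC -mulmxA -map_mxM mulVmx // map_mx1 mulmx1.
rewrite !det_mulmx mulrC mulrA -det_mulmx -map_mxM mulmxV // map_mx1 det1 mul1r.
by [].
Qed.

End Krylov.

Lemma char_poly_ex (R : comNzRingType) (k : nat) (p : {poly R}) :
  p \is monic -> size p = k.+1 -> exists A : 'M[R]_k, char_poly A = p.
Proof.
move=> p_mon sz_p; have -> : k = (size p).-1 by rewrite sz_p.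
by exists (companionmx p); apply: companionmxK.
Qed.

Lemma card_GL_unitmx (F : finFieldType) n :
  #|'GL_n.+1[F]%g| = #|[set P : 'M[F]_n.+1 | P \in unitmx]|.
Proof.
rewrite cardsE -(card_imset predT val_inj); apply: eq_card => P.
apply/imsetP/idP => [[u _ ->]|]; rewrite inE; first exact: (valP u).
by move=> P_unit; exists (Sub P P_unit : {'GL_n.+1[F]}); rewrite ?SubK.
Qed.

(** The matrix A corresponds to the invertible matrix with rows e0 *m A^i, whose
    first row is e0. Multiplication by Krylov matrices shows that every nonzero
    vector is the first row of the same number of invertible matrices. *)
Lemma card_char_poly (F : finFieldType) n (f : {poly F}) :
    f \is monic -> size f = n.+2 -> irreducible_poly f ->
  (#|[set A : 'M[F]_n.+1 | char_poly A == f]| * (#|F| ^ n.+1).-1 =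
   #|'GL_n.+1[F]%g|)%N.
Proof.
move=> f_mon sz_f f_irr; have [A0 A0f] := char_poly_ex f_mon sz_f.
pose GL := [set P : 'M[F]_n.+1 | P \in unitmx].
pose fib (v : 'rV[F]_n.+1) := [set P in GL | row 0 P == v].
pose e0 : 'rV[F]_n.+1 := delta_mx 0 0.
have e0_neq0 : e0 != 0.
  by apply/eqP => /rowP/(_ 0); rewrite !mxE eqxx => /eqP; rewrite oner_eq0.
have K_unit A v : char_poly A = f -> v != 0 -> krylov A v \in unitmx.
  by move=> Af; apply: krylov_unit; rewrite Af.
have row0_mul (P G : 'M[F]_n.+1) : row 0 (P *m G) = row 0 P *m G by apply: row_mul.
have card_fib v : v != 0 -> #|fib v| = #|fib e0|.
  move=> v0; pose M := krylov A0 v.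
  have M_unit : M \in unitmx by apply: K_unit.
  have e0M : e0 *m M = v by rewrite -rowE krylov_row0.
  rewrite -[RHS](card_imset _ (can_inj (mulmxK M_unit) : injective (mulmx^~ M))).
  apply: eq_card => P; rewrite !inE; apply/andP/imsetP => [[P_unit /eqP Pv]|[P' + ->]].
    exists (P *m invmx M); last by rewrite mulmxKV.
    by rewrite !inE unitmx_mul P_unit unitmx_inv M_unit row0_mul Pv -e0M mulmxK ?eqxx.
  by rewrite !inE => /andP[P'_unit /eqP P'0]; rewrite unitmx_mul P'_unit M_unit row0_mul P'0 e0M.
have -> : #|[set A : 'M[F]_n.+1 | char_poly A == f]| = #|fib e0|.
  pose K0 := krylov A0 e0; have K0_unit : K0 \in unitmx by apply: K_unit.
  rewrite -(@card_in_imset _ _ (fun A => krylov A e0)); last first.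
    move=> A B; rewrite !inE => /eqP Af /eqP Bf; apply: krylov_inj; first by rewrite Af.
    exact: K_unit.
  apply: eq_card => P; rewrite !inE; apply/imsetP/andP => [[A + ->]|[P_unit /eqP P0]].
    by rewrite inE => /eqP Af; rewrite K_unit // krylov_row0 eqxx.
  pose G := invmx K0 *m P.
  have G_unit : G \in unitmx by rewrite unitmx_mul unitmx_inv K0_unit.
  have e0G : e0 *m G = e0.
    have e0K0 : e0 *m K0 = e0 by rewrite -rowE krylov_row0.
    by rewrite -{1}e0K0 mulmxA mulmxK // -rowE P0.
  exists (invmx G *m A0 *m G); first by rewrite inE char_poly_conj ?A0f.
  by rewrite krylov_conj // mulmxA mulmxV // mul1mx.
rewrite card_GL_unitmx -/GL -[RHS]sum1_card.
rewrite (partition_big (row 0) (fun v => v != 0)) /= => [|P]; last first.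
  rewrite inE => P_unit; apply: contra_neq e0_neq0 => P0.
  by rewrite -(mulmxK P_unit e0) -rowE P0 mul0mx.
rewrite (eq_bigr (fun=> #|fib e0|)) => [|v v0].
  rewrite sum_nat_const mulnC; congr (_ * _)%N.
  by rewrite -[X in (_ ^ X)%N]mul1n -card_mx -(cardC1 (0 : 'rV[F]_n.+1)).
by rewrite -(card_fib v v0) -sum1_card; apply: eq_bigl => P; rewrite [RHS]inE.
Qed.

(** A monic polynomial of degree m over F that vanishes at an element of degree
    m is its minimal polynomial. *)
Lemma card_eigenvalue (F E : finFieldType) (emb : {rmorphism F -> E}) m (b : E) :
    (0 < m)%N -> deg emb b = m ->
  (#|[set A : 'M[F]_m | eigenvalue (map_mx emb A) b]| * (#|F| ^ m).-1 =
   #|'GL_m[F]%g|)%N.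
Proof.
case: m => // n _ deg_b.
have [f [f_mon sz_f fb]] := min_poly_ex emb b; rewrite deg_b in sz_f.
have f_irr : irreducible_poly f by apply: deg_irreducible fb _; rewrite deg_b.
rewrite -(card_char_poly f_mon sz_f f_irr); congr (_ * _)%N.
apply: eq_card => A; rewrite !inE eigenvalue_root_char -map_char_poly.
apply/idP/eqP => [Ab|->//].
apply/eqP; rewrite -subr_eq0; apply/negPn/negP => dif.
have /(deg_root_emb_le dif) : root (map_poly emb (char_poly A - f)) b.
  by rewrite rmorphB /root hornerD hornerN (eqP Ab) (eqP fb) subrr.
rewrite deg_b ltnNge => /negP; apply; apply/leq_sizeP => j n_j.
have coef_monic (p : {poly F}) : p \is monic -> size p = n.+2 -> p`_j = (j == n.+1)%:R.
  move=> /monicP p_lead sz_p; case: eqP => [->|/eqP j_neq].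
    by rewrite -p_lead lead_coefE sz_p.
  by rewrite nth_default // sz_p ltn_neqAle eq_sym j_neq.
by rewrite coefB !coef_monic ?char_poly_monic ?size_char_poly ?subrr.
Qed.

(** * Irreducible transformation shift registers *)

Section TSREigen.
Variables (F E : finFieldType) (emb : {rmorphism F -> E}).

Lemma mul_mxrow_tsr n m (c : {ffun 'I_n.+1 -> F}) (A : 'M[F]_m) (v : 'I_n.+1 -> 'rV[E]_m) :
  (\mxrow_i v i) *m map_mx emb (tsr_mx c A) =
  \mxrow_(j < n.+1) (if j.+1 == n.+1 then \sum_i emb (c i) *: (v i *m map_mx emb A)
             else v (inord j.+1)).
Proof.
have -> : map_mx emb (tsr_mx c A) = \mxblock_(i < n.+1, j < n.+1)
    (if j.+1 == n.+1 then emb (c i) *: map_mx emb A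
     else if i == j.+1 :> nat then 1%:M else 0).
  apply/matrixP => s t; rewrite !mxE; case: ifP => _; first by rewrite !mxE rmorphM.
  by case: ifP => _; rewrite !mxE ?rmorph0 // rmorph_nat.
rewrite mul_mxrow_mxblock; apply: eq_mxrow => j; case: eqP => [_|/eqP j_n].
  by apply: eq_bigr => i _; rewrite scalemxAr.
have lt_j : (j.+1 < n.+1)%N by rewrite ltn_neqAle j_n ltn_ord.
rewrite (bigD1 (inord j.+1)) //= inordK // eqxx mulmx1 big1 ?addr0 // => i i_j.
rewrite ifN ?mulmx0 //; apply: contraNneq i_j => <-; by rewrite inord_val.
Qed.

(** The first n blocks of the eigenvector equation force the eigenvector to be
    (u, x u, ..., x^n u), and the last one is the stated relation. *)
Lemma eigenvalue_tsrP n m (c : {ffun 'I_n.+1 -> F}) (A : 'M[F]_m) (x : E) :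
  reflect (exists2 u : 'rV[E]_m, u != 0 &
             (\sum_i emb (c i) * x ^+ i) *: (u *m map_mx emb A) = x ^+ n.+1 *: u)
          (eigenvalue (map_mx emb (tsr_mx c A)) x).
Proof.
apply: (iffP eigenvalueP) => [[v vT v0]|[u u0 uA]].
  pose w i := submxrow v i; have vE : v = \mxrow_i w i by rewrite submxrowK.
  move: vT; rewrite {1}vE mul_mxrow_tsr => vT.
  have wS (j : 'I_n.+1) : (if j.+1 == n.+1 then \sum_i emb (c i) *: (w i *m map_mx emb A)
             else w (inord j.+1)) = x *: w j.
    have := congr1 (fun M => submxrow M j) vT; rewrite mxrowK => ->.
    by apply/matrixP => s t; rewrite !mxE.
  have wE i : w i = x ^+ i *: w 0.
    case: i => i lt_i; elim: i lt_i => [|i IHi] lt_i.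
      by rewrite expr0 scale1r; congr w; apply: val_inj.
    have := wS (Ordinal (ltnW lt_i)); rewrite /= ifN ?neq_ltn ?lt_i // => wi.
    rewrite exprS -scalerA -(IHi (ltnW lt_i)) -wi; congr w.
    by apply: val_inj; rewrite /= inordK.
  exists (w 0).
    apply: contra_neq v0 => w0; rewrite vE; apply/mxrowP => j.
    by rewrite mxrowK wE w0 scaler0 submxrow0.
  have := wS ord_max; rewrite /= eqxx (wE ord_max) scalerA -exprS => <-.
  rewrite scaler_suml; apply: eq_bigr => i _.
  by rewrite (wE i) -scalemxAl scalerA.
exists (\mxrow_(i < n.+1) (x ^+ i *: u)).
  rewrite mul_mxrow_tsr; apply/mxrowP => j.
  have -> : submxrow (x *: \mxrow_(i < n.+1) (x ^+ i *: u)) j = x ^+ j.+1 *: u.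
    rewrite exprS -scalerA -[in RHS](mxrowK (fun i : 'I_n.+1 => x ^+ i *: u)).
    by apply/matrixP => s t; rewrite !mxE.
  rewrite mxrowK; case: eqP => [->|/eqP j_n].
    rewrite -uA scaler_suml; apply: eq_bigr => i _.
    by rewrite -scalemxAl scalerA.
  by rewrite inordK // ltn_neqAle j_n ltn_ord.
apply: contra_neq u0 => /(congr1 (fun M => submxrow M 0)).
by rewrite mxrowK submxrow0 expr0 scale1r.
Qed.

End TSREigen.

Section IrreducibleTSR.
Variables (F E : finFieldType) (emb : {rmorphism F -> E}) (m : nat).
Hypothesis m_gt0 : (0 < m)%N.
Hypothesis root_E : forall p : {poly F}, size p = (3 * m).+1 ->
  exists x, root (map_poly emb p) x.
Local Notation deg := (deg emb).
Local Notation Fix := (Fix emb).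
Local Notation "A ^E" := (map_mx emb A) (at level 2, format "A ^E").

Lemma irreducible_tsrP (c : {ffun 'I_3 -> F}) (A : 'M[F]_m) :
  irreducible_poly (char_poly (tsr_mx c A)) <->
  exists2 x, deg x = (3 * m)%N & eigenvalue (tsr_mx c A)^E x.
Proof.
have sz : size (char_poly (tsr_mx c A)) = (3 * m).+1.
  by rewrite size_char_poly sum_nat_const card_ord.
split=> [T_irr | [x deg_x]].
  have [x Tx] := root_E sz; exists x; first by rewrite (irreducible_deg T_irr Tx) sz.
  by rewrite eigenvalue_root_char -map_char_poly.
rewrite eigenvalue_root_char -map_char_poly => Tx.
by apply: deg_irreducible Tx _; rewrite sz deg_x.
Qed.

Lemma deg_eigenvalue (A : 'M[F]_m) b : eigenvalue A^E b -> (deg b <= m)%N.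
Proof.
rewrite eigenvalue_root_char -map_char_poly => Ab.
rewrite -ltnS -(size_char_poly A); apply: deg_root_emb_le Ab.
by rewrite monic_neq0 ?char_poly_monic.
Qed.

Lemma deg_neq0 x : deg x = (3 * m)%N -> x != 0.
Proof.
move=> deg_x; apply/eqP => x0; move: deg_x.
by rewrite x0 -(rmorph0 emb) deg_emb; lia.
Qed.

Lemma eigenvalue_tsr_ratio (c : {ffun 'I_3 -> F}) (A : 'M[F]_m) x :
    deg x = (3 * m)%N -> let g := \sum_i emb (c i) * x ^+ i in
  eigenvalue (tsr_mx c A)^E x = (g != 0) && eigenvalue A^E (x ^+ 3 / g).
Proof.
move=> deg_x g; have x0 := deg_neq0 deg_x.
apply/eigenvalue_tsrP/andP => [[u u0 uA]|[g0 /eigenvalueP[u uA u0]]].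
  have g0 : g != 0.
    apply: contra_neq u0 => g0; move/eqP: uA; rewrite -/g g0 scale0r eq_sym.
    by rewrite scaler_eq0 expf_eq0 (negPf x0) => /eqP.
  split=> //; apply/eigenvalueP; exists u => //.
  by rewrite mulrC -scalerA -uA scalerA mulVf ?scale1r.
by exists u => //; rewrite uA scalerA mulrC divfK.
Qed.

(** The equation makes x cubic over the field generated by b, which needs
    deg b >= m; if c 0 vanished, a factor x would cancel and x would be
    quadratic. *)
Lemma deg_ratio (c : {ffun 'I_3 -> F}) (b x : E) : deg x = (3 * m)%N ->
    x ^+ 3 = b * \sum_i emb (c i) * x ^+ i -> (deg b <= m)%N ->
  c 0 != 0 /\ deg b = m.
Proof.
move=> deg_x xE deg_b.
have bK i : b * emb (c (inord i)) \in Fix (deg b).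
  by rewrite rpredM ?Fix_emb // FixE.
split.
  apply/negP => /eqP c0; suff : (deg x <= 2 * deg b)%N by rewrite deg_x; lia.
  (* after cancelling x: x^2 = b (c 1 + c 2 x) *)
  apply: (@deg_le_monic _ _ _ _ _ (fun i => b * emb (c (inord i.+1)))) => //.
    exact: deg_gt0.
  apply: (mulfI (deg_neq0 deg_x)); rewrite -exprS xE big_ord_recl c0 rmorph0 mul0r add0r.
  rewrite !mulr_sumr; apply: eq_bigr => i _ /=.
  rewrite (_ : lift ord0 i = inord i.+1) ?inordK ?ltnS // ?exprS; first by ring.
  by apply: val_inj; rewrite /= inordK // ltnS.
apply/eqP; rewrite eqn_leq deg_b -(leq_pmul2l (isT : 0 < 3)%N) -deg_x.
apply: (@deg_le_monic _ _ _ _ _ (fun i => b * emb (c (inord i)))) => //.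
  exact: deg_gt0.
by rewrite xE mulr_sumr; apply: eq_bigr => i _; rewrite inord_val mulrA.
Qed.

Definition normal_coef (a b : F) : {ffun 'I_3 -> F} := [ffun i : 'I_3 => [:: 1; a; b]`_i].

Lemma tsr_mx_normalize (c : {ffun 'I_3 -> F}) (A : 'M[F]_m) : c 0 != 0 ->
  tsr_mx c A = tsr_mx (normal_coef (c 1 / c 0) (c 2%:R / c 0)) (c 0 *: A).
Proof.
move=> c0; apply/eq_mxblockP => i j; case: ifP => // _.
rewrite scalerA ffunE; congr (_ *: _).
case: i => -[|[|[|//]]] lt_i /=; rewrite ?mul1r ?divfK //; congr (c _); exact: val_inj.
Qed.

Definition deg_missed_eigen (a b : F) (A : 'M[F]_m) :=
  [set g in deg_missed emb m a b | eigenvalue A^E g^-1].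

(** Reversing the polynomial 1 + a x + b x^2 turns the ratio x^3 / (1 + a x +
    b x^2) into the inverse of the value of a cubic at 1 / x. *)
Lemma sum_normal_coef a b (x : E) : x != 0 ->
  \sum_i emb (normal_coef a b i) * x ^+ i = x ^+ 3 * cubic (emb a) (emb b) x^-1.
Proof.
move=> x0; rewrite !big_ord_recl big_ord0 !ffunE /= rmorph1 /cubic.
by rewrite /bump /=; field.
Qed.

Lemma deg_missedP a b g :
    (forall (a b : F) g, g \in Fix m -> exists r, cubic (emb a) (emb b) r = g) ->
  reflect (deg g = m /\ exists2 y, deg y = (3 * m)%N & cubic (emb a) (emb b) y = g)
          (g \in deg_missed emb m a b).
Proof.
move=> surj; rewrite inE; apply: (iffP andP) => [[/eqP deg_g g_missed]|[deg_g [y deg_y yg]]].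
  split=> //; have [|y yg] := surj a b g; first by rewrite FixE deg_g.
  by exists y => //; have := @missed_degE _ _ emb m a b y; rewrite yg; apply.
rewrite deg_g eqxx; split=> //.
by have := @deg3_missed _ _ emb m a b y; rewrite yg; apply.
Qed.

Lemma deg_missed_neq0 a b g : g \in deg_missed emb m a b -> g != 0.
Proof.
rewrite inE => /andP[_ /missedP[_ no_root]]; apply/negP => /eqP g0.
by apply: (no_root 0); rewrite ?rpred0 // g0 /cubic !expr0n /= !mulr0 !addr0.
Qed.

Hypothesis cubic_surj : forall (a b : F) g, g \in Fix m ->
  exists r, cubic (emb a) (emb b) r = g.

(** The inverse eigenvalue g = x^-3 (1 + a x + b x^2) of A has degree m and the
    preimage 1 / x of degree 3 m under the cubic. *)
Lemma irreducible_normalP a b (A : 'M[F]_m) :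
  irreducible_poly (char_poly (tsr_mx (normal_coef a b) A)) <->
  deg_missed_eigen a b A != set0.
Proof.
rewrite irreducible_tsrP; split=> [[x deg_x]|/set0Pn[g]]; last first.
  rewrite inE => /andP[g_missed Ag].
  have [deg_g [y deg_y yg]] := deg_missedP _ _ _ cubic_surj g_missed.
  have y0 := deg_neq0 deg_y; have g0 := deg_missed_neq0 g_missed.
  exists y^-1; rewrite ?degV // eigenvalue_tsr_ratio ?degV //.
  rewrite sum_normal_coef ?invr_eq0 // invrK yg.
  rewrite mulf_neq0 ?expf_neq0 ?invr_eq0 //=.
  by rewrite invfM mulrA mulfV ?mul1r // expf_neq0 // invr_eq0.
have x0 := deg_neq0 deg_x; rewrite eigenvalue_tsr_ratio // sum_normal_coef //.
set g := cubic _ _ _; rewrite mulf_eq0 negb_or expf_neq0 //= => /andP[g0].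
rewrite invfM mulrA mulfV ?mul1r ?expf_neq0 // => Ag.
apply/set0Pn; exists g; rewrite inE Ag andbT; apply/(deg_missedP _ _ _ cubic_surj).
split; last by exists x^-1; rewrite ?degV.
rewrite -degV; have [|_ -> //] := @deg_ratio (normal_coef a b) g^-1 x deg_x _ (deg_eigenvalue Ag).
by rewrite sum_normal_coef // -/g mulrCA mulVf ?mulr1.
Qed.

Lemma normal_mx_inj a b (A : 'M[F]_m) a' b' (A' : 'M[F]_m) : A != 0 ->
  tsr_mx (normal_coef a b) A = tsr_mx (normal_coef a' b') A' ->
  [/\ a = a', b = b' & A = A'].
Proof.
move=> A0; rewrite /tsr_mx => /eq_mxblockP eqT.
have eq_c (i : 'I_3) : normal_coef a b i *: A = normal_coef a' b' i *: A'.
  exact: (eqT i ord_max).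
have eqA : A = A' by have := eq_c 0; rewrite !ffunE /= !scale1r.
have scal_inj k l : k *: A = l *: A' -> k = l.
  move/eqP; rewrite -eqA -subr_eq0 -scalerBl scaler_eq0 (negPf A0) orbF subr_eq0.
  by move/eqP.
split=> //; apply: scal_inj; [have := eq_c 1 | have := eq_c 2%:R]; by rewrite !ffunE.
Qed.

Definition normal_data :=
  [set t : (F * F) * 'M[F]_m | deg_missed_eigen t.1.1 t.1.2 t.2 != set0].

(** Irreducibility forces c 0 != 0, so each irreducible register has exactly one
    presentation with c 0 = 1. *)
Lemma card_TSRI_normal : #|TSRI F m 3| = #|normal_data|.
Proof.
pose f (t : (F * F) * 'M[F]_m) := tsr_mx (normal_coef t.1.1 t.1.2) t.2.
rewrite -(@card_in_imset _ _ f normal_data) => [|[[a b] A] [[a' b'] A']]; last first.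
  rewrite !inE /= => /set0Pn[g]; rewrite inE => /andP[g_missed Ag] _ eq_f.
  have [|/= -> -> ->] := normal_mx_inj _ eq_f; last by [].
  rewrite /=.
  apply: contraTneq Ag => ->; rewrite map_mx0; apply/eigenvalueP => -[v].
  rewrite mulmx0 => /esym/eqP; rewrite scaler_eq0 invr_eq0.
  by rewrite (negPf (deg_missed_neq0 g_missed)) /= => ->.
apply: eq_card => T.
apply/setIdP/imsetP => [[/imset2P[c A _ _ ->] /irreducibleP T_irr]|[[[a b] A]]].
  have [x deg_x] := (irreducible_tsrP c A).1 T_irr.
  rewrite eigenvalue_tsr_ratio // => /andP[g0 Ax].
  have [|c0 _] := @deg_ratio c _ x deg_x _ (deg_eigenvalue Ax); first by rewrite divfK.
  exists ((c 1 / c 0, c 2%:R / c 0), c 0 *: A); last exact: tsr_mx_normalize.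
  by rewrite inE /=; apply/irreducible_normalP; rewrite -tsr_mx_normalize.
rewrite inE /= => /irreducible_normalP T_irr ->; split; last exact/irreducibleP.
by apply/imset2P; exists (normal_coef a b) A.
Qed.

(** The eigenvalues of A are the m conjugates of one of them, and the conditions
    on g are invariant under conjugation. *)
Lemma card_deg_missed_eigen a b (A : 'M[F]_m) :
  deg_missed_eigen a b A != set0 -> #|deg_missed_eigen a b A| = m.
Proof.
case/set0Pn=> g; rewrite inE => /andP[g_missed Ag]; apply/eqP; rewrite eqn_leq.
have [deg_g [y deg_y yg]] := deg_missedP _ _ _ cubic_surj g_missed.
apply/andP; split.
  rewrite -(card_imset _ (@invr_inj E)) -ltnS -(size_char_poly A) -(size_map_poly emb).
  rewrite cardE; apply: max_poly_roots; rewrite ?enum_uniq //.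
    by rewrite map_poly_eq0 monic_neq0 ?char_poly_monic.
  apply/allP => z; rewrite mem_enum => /imsetP[w + ->]; rewrite inE => /andP[_].
  by rewrite eigenvalue_root_char -map_char_poly.
pose f (i : 'I_m) := frob emb i g.
have f_inj : injective f.
  move=> i j eq_ij; apply: val_inj.
  by apply: (@frob_ltn_inj _ _ emb g _ _ _ _ eq_ij); rewrite deg_g; apply: ltn_ord.
rewrite -[leqLHS]card_ord -(card_imset _ f_inj); apply/subset_leq_card/subsetP => _ /imsetP[i _ ->].
rewrite inE; apply/andP; split.
  apply/(deg_missedP _ _ _ cubic_surj); rewrite deg_conj; split=> //.
  by exists (frob emb i y); rewrite ?deg_conj // -frob_cubic yg.
rewrite /f -fmorphV eigenvalue_root_char -map_char_poly /= -[val i]muln1.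
apply: frob_root; first exact: map_frob_emb.
by rewrite map_char_poly -eigenvalue_root_char.
Qed.

(** Double counting of the triples (a, b, A) together with an inverse eigenvalue
    g of A: there are m values g for each irreducible register, and
    |GL_m| / (q^m - 1) matrices A for each g. *)
Lemma card_TSRI :
  (m * (#|F| ^ m).-1 * #|TSRI F m 3| =
   #|'GL_m[F]%g| * \sum_(a : F) \sum_(b : F) #|deg_missed emb m a b|)%N.
Proof.
have -> : (m * (#|F| ^ m).-1 * #|TSRI F m 3| = (#|F| ^ m).-1 * (m * #|TSRI F m 3|))%N by lia.
have -> : (m * #|TSRI F m 3| =
  \sum_(a : F) \sum_(b : F) \sum_(A : 'M[F]_m) #|deg_missed_eigen a b A|)%N.
  rewrite card_TSRI_normal pair_bigA pair_bigA /= mulnC -sum_nat_const big_mkcond.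
  apply: eq_bigr => t _ /=; rewrite inE; case: ifPn => [/card_deg_missed_eigen//|].
  by rewrite negbK => /eqP->; rewrite cards0.
rewrite !big_distrr /=; apply: eq_bigr => a _.
rewrite !big_distrr /=; apply: eq_bigr => b _.
transitivity (\sum_(g in deg_missed emb m a b)
    #|[set A : 'M[F]_m | eigenvalue A^E g^-1]| * (#|F| ^ m).-1)%N; last first.
  rewrite mulnC -sum_nat_const; apply: eq_bigr => g; rewrite inE => /andP[/eqP deg_g _].
  by apply: card_eigenvalue; rewrite ?degV.
rewrite -big_distrl mulnC /=; congr (_ * _)%N.
under eq_bigr do rewrite -sum1_card big_mkcond /=.
under [RHS]eq_bigr do rewrite -sum1_card big_mkcond /=.
rewrite exchange_big [RHS]big_mkcond /=; apply: eq_bigr => g _.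
case: ifP => g_missed; last by rewrite big1 // => A _; rewrite inE g_missed.
by apply: eq_bigr => A _; rewrite [g \in _]inE g_missed [A \in _]inE.
Qed.

End IrreducibleTSR.

(** * The count in terms of missed values *)

Section Assembly.

Variables (F E : finFieldType) (emb : {rmorphism F -> E}) (m : nat).
Hypothesis m_gt0 : (0 < m)%N.
Local Notation q := #|F|.
Hypothesis splits : forall p : {poly F}, p != 0 -> (size p <= (3 * q ^ m + 3 * m).+1)%N ->
  exists rs : seq E, map_poly emb p %= \prod_(r <- rs) ('X - r%:P).

Let q_gt1 : (1 < q)%N. Proof. exact: finNzRing_gt1. Qed.
Let Q_gt1 : (1 < q ^ m)%N. Proof. by rewrite -(exp1n m) ltn_exp2r. Qed.

Lemma split_root (p : {poly E}) rs : p %| \prod_(r <- rs) ('X - r%:P) ->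
  (1 < size p)%N -> exists x, root p x.
Proof.
case/dvdp_prod_XsubC => b pb sz_p; case: (mask b rs) pb => [|x s] pb.
  by move/eqp_size: pb sz_p => ->; rewrite big_nil size_poly1.
by exists x; rewrite (eqp_root pb) root_prod_XsubC mem_head.
Qed.

Lemma root_extension (p : {poly F}) : (1 < size p)%N ->
  (size p <= (3 * q ^ m + 3 * m).+1)%N -> exists x, root (map_poly emb p) x.
Proof.
move=> p_gt1 p_le; have p0 : p != 0 by rewrite -size_poly_gt0 ltnW.
have [rs rsP] := splits p0 p_le.
apply: (@split_root _ rs); last by rewrite size_map_poly.
by rewrite (eqp_dvdl _ rsP) dvdpp.
Qed.

Lemma card_Fix_extension d : (d %| m)%N -> #|Fix emb d| = (q ^ d)%N.
Proof.
move=> dm; have d_gt0 := dvdn_gt0 m_gt0 dm.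
have qd_gt1 : (1 < q ^ d)%N by rewrite -(exp1n d) ltn_exp2r.
have sz : size ('X^(q ^ d) - 'X : {poly F}) = (q ^ d).+1.
  by rewrite size_polyDl ?size_polyXn // size_polyN size_polyX.
apply: card_Fix => //; have [||rs] := @splits ('X^(q ^ d) - 'X).
- by rewrite -size_poly_eq0 sz.
- have : (q ^ d <= q ^ m)%N by rewrite leq_exp2l // dvdn_leq.
  by rewrite sz; lia.
by rewrite rmorphB /= map_polyXn map_polyX => rsP; exists rs.
Qed.

(** The polynomial h^(q^m) - h has coefficients in F, hence splits in E. It is
    divisible by h - g, because g^(q^m) = g. *)
Lemma cubic_extension (a b : F) g : g \in Fix emb m ->
  exists r, cubic (emb a) (emb b) r = g.
Proof.
move=> gK; pose h : {poly F} := 'X^3 + (a *: 'X^2 + b *: 'X).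
have sz_h : size h = 4.
  rewrite size_polyDl size_polyXn // (leq_ltn_trans (size_polyD _ _)) // gtn_max.
  by rewrite !(leq_ltn_trans (size_scale_leq _ _)) ?size_polyXn ?size_polyX.
have h_mon : h \is monic.
  by rewrite monicE lead_coefE sz_h !coefD !coefZ !coefXn coefX /= !mulr0 !addr0.
have h0 := monic_neq0 h_mon.
have sz_hQ : size (h ^+ (q ^ m) - h) = (3 * q ^ m).+1.
  have sz_exp : size (h ^+ (q ^ m)) = (3 * q ^ m).+1.
    by rewrite -[LHS]prednK ?size_poly_gt0 ?expf_neq0 // size_exp sz_h.
  by rewrite size_polyDl // size_polyN sz_exp sz_h; move: Q_gt1; lia.
have [||rs rsP] := @splits (h ^+ (q ^ m) - h).
- by rewrite -size_poly_eq0 sz_hQ.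
- by rewrite sz_hQ; lia.
have sz_hg : size (map_poly emb h - g%:P) = 4.
  rewrite size_polyDl ?size_map_poly //.
  by rewrite size_polyN sz_h (leq_ltn_trans (size_polyC_leq1 _)).
have [||r hr] := @split_root (map_poly emb h - g%:P) rs.
- rewrite -(eqp_dvdr _ rsP) rmorphB rmorphXn /=.
  have gQ : g ^+ (q ^ m) = g by exact: (Fix_frob gK).
  have -> : map_poly emb h ^+ (q ^ m) - map_poly emb h =
      (map_poly emb h ^+ (q ^ m) - g%:P ^+ (q ^ m)) - (map_poly emb h - g%:P).
    by rewrite -polyC_exp gQ; ring.
  by apply: dvdp_sub => //; rewrite subrXX dvdp_mulr.
- by rewrite sz_hg.
exists r; move: hr; rewrite /root !hornerE !rmorphD /= map_polyXn !map_polyZ map_polyXn map_polyX.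
by rewrite !hornerE subr_eq0 => /eqP <-; rewrite /cubic /=; ring.
Qed.

Lemma card_TSRI_sum (c : rat) (X : nat -> rat) :
    (forall n, (n %| m)%N -> 3 * (total_missed emb n)%:R = c * X n) ->
  #|TSRI F m 3|%:R = c * #|'GL_m[F]%g|%:R / (3 * m%:R * (q%:R ^+ m - 1)) *
     \sum_(d <- divisors m | ~~ (3 %| d)%N) (mobius d)%:~R * X (m %/ d)%N.
Proof.
move=> total_E.
have m0 : m%:R != 0 :> rat by rewrite pnatr_eq0 -lt0n.
have Q0 : q%:R ^+ m - 1 != 0 :> rat.
  by rewrite subr_eq0 -natrX pnatr_eq1 gtn_eqF.
have root3m (p : {poly F}) : size p = (3 * m).+1 -> exists x, root (map_poly emb p) x.
  by move=> sz_p; apply: root_extension; rewrite sz_p; lia.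
have /(congr1 (fun k => k%:R : rat)) := card_TSRI m_gt0 root3m cubic_extension.
rewrite !natrM (sum_deg_missed m_gt0 cubic_extension).
rewrite -subn1 natrB ?(ltnW Q_gt1) // natrX => tsri.
set S := \sum_(d <- divisors m | _) (mobius d)%:~R * X (m %/ d)%N.
have -> : c * #|'GL_m[F]%g|%:R / (3 * m%:R * (q%:R ^+ m - 1)) * S =
    #|'GL_m[F]%g|%:R * (c / 3 * S) / (m%:R * (q%:R ^+ m - 1)).
  by field; rewrite m0 Q0.
apply: (canRL (mulfK _)); first by rewrite mulf_neq0.
rewrite mulrC tsri; congr (_ * _); rewrite mulr_sumr.
rewrite big_seq_cond [RHS]big_seq_cond; apply: eq_bigr => d /andP[+ _].
rewrite -dvdn_divisors // => dm; have := total_E _ (dvdn_div dm) => total_d.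
rewrite mulrCA; congr (_ * _); apply: (mulfI (_ : 3 != 0 :> rat)) => //.
by rewrite total_d; field.
Qed.

End Assembly.

(** * Evaluation of the sum *)

Lemma card_pow3P (F : finFieldType) :
  (exists k : nat, #|F| = (3 ^ k)%N) <-> (3 : F) = 0.
Proof.
split=> [[[|k] qk]|F3].
- by have := finNzRing_gt1 F; rewrite qk.
- exact: pcharf0 (card_finPcharP qk _).
have F3' : 3%N \in [pchar F] by rewrite inE F3 eqxx.
by exists (logn 3 #|pPrimeCharType F3'|); apply: (card_pprimeChar F3').
Qed.

Lemma card_mod3 (F : finFieldType) : (3 : F) != 0 -> (#|F| %% 3 != 0)%N.
Proof.
move=> F3; have [p p_pr pF] := finPcharP F.
have -> : #|F| = (p ^ logn p #|F|)%N := card_pprimeChar pF.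
apply/negP => /eqP/eqP; rewrite -/(dvdn 3 _) Euclid_dvdX // => /andP[p3 _].
move: F3; rewrite (_ : 3%N = p) ?pcharf0 ?eqxx //.
by apply/eqP; rewrite -dvdn_prime2.
Qed.

Lemma legendre3E q : (q %% 3 != 0)%N ->
  legendre q 3 = if (q %% 3 == 1)%N then 1 else -1.
Proof.
rewrite /legendre /dvdn => q_mod; rewrite (negPf q_mod); congr (if _ then _ else _).
apply/existsP/eqP => [[x]|q1]; last by exists (inord 1); rewrite inordK // q1.
have := ltn_pmod q (isT : 0 < 3)%N.
by case: x => -[|[|[|//]]] ? /=; case: (q %% 3)%N q_mod => [|[|[|]]].
Qed.

Section Cases.

Variables (F E : finFieldType) (emb : {rmorphism F -> E}) (n : nat).
Hypothesis card_K : #|Fix emb n| = (#|F| ^ n)%N.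
Local Notation q := #|F|.
Let q_gt0 : (0 < q)%N. Proof. exact: ltnW (finNzRing_gt1 F). Qed.

Lemma total_missed_legendre (w : E) : (0 < n)%N -> (3 : F) != 0 ->
    w ^+ 2 + w + 1 = 0 -> let eps : rat := (legendre q 3)%:~R in
  3 * (total_missed emb n)%:R =
    q%:R * ((q%:R + eps ^+ n) * (q%:R ^+ n - eps ^+ n)) :> rat.
Proof.
move=> n_gt0 F3 wP; rewrite legendre3E ?card_mod3 //=.
have Q_gt0 : (0 < q ^ n)%N by rewrite expn_gt0 q_gt0.
have split_case : (q ^ n %% 3 = 1)%N -> 3 * (total_missed emb n)%:R =
    q%:R * ((q%:R + 1) * (q%:R ^+ n - 1)) :> rat.
  move=> Q1; rewrite -natrM (total_missed_split card_K F3 wP) ?omega_Fix ?Q1 //.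
  by rewrite !natrM -subn1 natrB // natrX -natr1.
have inert_case : (q ^ n %% 3 = 2)%N -> 3 * (total_missed emb n)%:R =
    q%:R * ((q%:R + -1) * (q%:R ^+ n - -1)) :> rat.
  move=> Q2; rewrite -natrM (total_missed_inert card_K F3 wP) ?omega_Fix ?Q2 //.
  by rewrite !natrM -subn1 natrB // -[(q ^ n).+1]addn1 natrD natrX opprK.
have q_lt3 := ltn_pmod q (isT : 0 < 3)%N.
case: eqP => [q1|q1]; first by rewrite rmorph1 expr1n split_case // -modnXm q1 exp1n.
have q2 : (q %% 3 = 2)%N.
  by move: (card_mod3 F3) q_lt3 q1; case: (q %% 3)%N => [|[|[|]]].
have Q_mod : (q ^ n %% 3 = if odd n then 2 else 1)%N.
  rewrite -modnXm q2; elim: (n) => // k IHk.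
  by rewrite expnS -modnMmr IHk /=; case: (odd k).
rewrite rmorphN rmorph1 -signr_odd; case: (odd n) Q_mod => Q_mod.
  by rewrite expr1 inert_case.
by rewrite expr0 split_case.
Qed.

Lemma total_missed_pow3 : (0 < n)%N -> (3 : F) = 0 ->
    (forall a : F, exists r : E, r ^+ 2 = emb a) ->
  3 * (total_missed emb n)%:R =
    (q%:R - 1) * ((q%:R + (3 + (-1) ^+ n) / 2) * q%:R ^+ n) :> rat.
Proof.
move=> n_gt0 F3 sqrtE; have E3 : (3 : E) = 0 by rewrite -(rmorph_nat emb) F3 rmorph0.
rewrite -natrM (total_missed3 card_K E3 sqrtE) // !natrM natrD natrX -subn1 natrB //.
rewrite -mulrA; congr (_ * ((_ + _) * _)); rewrite -[in RHS]signr_odd.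
by case: (odd n); rewrite /= ?expr1 ?expr0; field.
Qed.

End Cases.

Theorem theorem22 (F : finFieldType) (q m : nat)
    (card_F : #|F| = q) (m_gt0 : (0 < m)%N) :
  (~ (exists k : nat, q = (3 ^ k)%N) ->
    let eps : rat := (legendre q 3)%:~R in
    #|TSRI F m 3|%:R =
      q%:R * #|'GL_m[F]%g|%:R / (3 * m%:R * (q%:R ^+ m - 1)) *
      (\sum_(d <- divisors m | ~~ (3 %| d)%N)
         (mobius d)%:~R * (q%:R + eps ^+ (m %/ d)%N)
           * (q%:R ^+ (m %/ d)%N - eps ^+ (m %/ d)%N)) :> rat)
  /\
  ((exists k : nat, q = (3 ^ k)%N) ->
    #|TSRI F m 3|%:R =
      (q%:R - 1) * #|'GL_m[F]%g|%:R / (3 * m%:R * (q%:R ^+ m - 1)) *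
      (\sum_(d <- divisors m | ~~ (3 %| d)%N)
         (mobius d)%:~R * (q%:R + (3 + (-1) ^+ (m %/ d)%N) / 2)
           * q%:R ^+ (m %/ d)%N) :> rat).
Proof.
have [E [emb splits]] := splitting_extension F (3 * #|F| ^ m + 3 * m).+1.
have roots (p : {poly F}) : size p = 3 -> exists x, root (map_poly emb p) x.
  move=> sz_p; apply: (root_extension splits); rewrite sz_p //.
  by have := finNzRing_gt1 F; rewrite -{1}(expn1 #|F|) => /leq_trans/(_ (leq_pexp2l _ m_gt0)); lia.
rewrite -card_F; split=> [/card_pow3P/eqP F3 eps|/card_pow3P F3].
  have sz : size ('X^2 + ('X + 1) : {poly F}) = 3.
    by rewrite size_polyDl size_polyXn // size_polyDl ?size_polyX ?size_poly1.
  have [w] := roots _ sz; rewrite /root !rmorphD /= map_polyXn map_polyX rmorph1 !hornerE.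
  move=> /eqP w_root; have wP : w ^+ 2 + w + 1 = 0 := w_root.
  rewrite (card_TSRI_sum m_gt0 splits (X := fun n =>
     (#|F|%:R + eps ^+ n) * (#|F|%:R ^+ n - eps ^+ n)) (c := #|F|%:R)).
    by congr (_ * _); apply: eq_bigr => d _; rewrite mulrA.
  move=> n nm; apply: total_missed_legendre wP => //.
    exact: (card_Fix_extension m_gt0 splits).
  exact: dvdn_gt0 nm.
have sqrtE (a : F) : exists r : E, r ^+ 2 = emb a.
  have [|r] := roots ('X^2 - a%:P).
    by rewrite size_polyDl size_polyXn // size_polyN (leq_ltn_trans (size_polyC_leq1 _)).
  rewrite /root rmorphB /= map_polyXn map_polyC !hornerE subr_eq0 => /eqP ra.
  by exists r.
rewrite (card_TSRI_sum m_gt0 splits (X := fun n =>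
   (#|F|%:R + (3 + (-1) ^+ n) / 2) * #|F|%:R ^+ n) (c := #|F|%:R - 1)).
  by congr (_ * _); apply: eq_bigr => d _; rewrite mulrA.
move=> n nm; apply: total_missed_pow3 => //; last exact: dvdn_gt0 nm.
exact: (card_Fix_extension m_gt0 splits).
Qed.
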